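(* A locally convex space $(E,\mu)$ is a Mackey group if and only if it is a Mackey space and $\psi(\mathcal{CAC}(E')):=\{\psi(C): C\in\mathcal{CAC}(E')\}$ swallows $\mathrm{Mac}(E)$.
   Context: Locally convex spaces are real and Hausdorff; a locally convex space $E$ is also regarded as an abelian topological group under addition. $E'$ is the topological dual space of $E$, $\sigma(E',E)$ the weak$^\ast$ topology on $E'$, and $\mathcal{CAC}(E')$ is the family of all $\sigma(E',E)$-compact absolutely convex (nonempty) subsets of $E'$. $E$ is a Mackey space if its topology is the finest locally convex vector topology on $E$ with the same topological dual $E'$. Abelian groups are written additively. $\mathbb{S}$ is the unit circle group and $\mathbb{S}_+=\{z\in\mathbb{S}:\mathrm{Re}(z)\ge 0\}$. For an abelian topological group $G$, $\widehat{G}$ is the group of continuous characters (continuous homomorphisms $G\to\mathbb{S}$), $G^\ast$ is the group of all homomorphisms $G\to\mathbb{S}$, and $(\chi,g):=\chi(g)$. The canonical isomorphism $\psi:E'\to\widehat{E}$ is $\psi(\chi)(x)=\exp\{2\pi i\,\chi(x)\}$. For $A\subseteq G$: $A^{\triangleright}=\{\chi\in\widehat{G}:\chi(A)\subseteq\mathbb{S}_+\}$ and $A^{\blacktriangleright}=\{\chi\in G^\ast:\chi(A)\subseteq\mathbb{S}_+\}$. For $B\subseteq\widehat{G}$: $B^{\triangleleft}=\{g\in G:(\chi,g)\in\mathbb{S}_+ \text{ for all }\chi\in B\}$. For a subset $A$ of an abelian group, $(1)A:=A$ and $(n+1)A:=(n)A+A$. A subset $A$ of an abelian topological group $G$ is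 quasi-convex if for every $g\in G\setminus A$ there is $\chi\in\widehat{G}$ with $\chi(A)\subseteq\mathbb{S}_+$ and $\chi(g)\notin\mathbb{S}_+$. $G$ (or its topology) is locally quasi-convex if it is Hausdorff and has a neighborhood base at $0$ of quasi-convex sets. $\sigma(\widehat{G},G)$ is the topology of pointwise convergence on $G$; $\widehat{G}_{\sigma^\ast}:=(\widehat{G},\sigma(\widehat{G},G))$, whose continuous characters are (for $\widehat{G}$ separating points) exactly the evaluations at elements of $G$ (so $K\subseteq\widehat{G}_{\sigma^\ast}$ is quasi-convex iff $K=K^{\triangleleft\triangleright}$). $\mathrm{Mac}(G)$ is the family of all quasi-convex compact subsets $K$ of $\widehat{G}_{\sigma^\ast}$ such that for every finite $F\subseteq\widehat{G}$ with $0\in F$ and every integer $n\ge1$, the subset $((n)K+F)^{\triangleleft\blacktriangleright}$ of $G^\ast$ is contained in $\widehat{G}$. Two group topologies $\mu,\nu$ on $G$ are compatible if $\widehat{(G,\mu)}=\widehat{(G,\nu)}$. A locally quasi-convex abelian group $(G,\tau)$ is a Mackey group if $\nu\le\tau$ for every locally quasi-convex group topology $\nu$ on $G$ compatible with $\tau$. Every locally convex space is a locally quasi-convex group. A family $\mathcal{B}$ of sets swallows a family $\mathcal{A}$ if every $A\in\mathcal{A}$ is contained in some $B\in\mathcal{B}$. *)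

(* Defs.v *)
From HB Require Import structures.
From mathcomp Require Import all_boot all_order all_algebra complex.
From mathcomp Require Import all_classical all_reals all_analysis.

Set Implicit Arguments.
Unset Strict Implicit.
Unset Printing Implicit Defensive.

Import Order.TTheory GRing.Theory Num.Theory.
Import numFieldNormedType.Exports.

Local Open Scope classical_set_scope.
Local Open Scope ring_scope.
Local Open Scope complex_scope.

(* The circle group, written additively: `+` is complex multiplication. *)

Record circle (R : realType) := Circle {
  circle_val : R[i];
  circle_valP : `|circle_val| == 1 }.

HB.instance Definition _ (R : realType) := [isSub for @circle_val R].
HB.instance Definition _ (R : realType) := [Choice of circle R by <:].

Section circle_group.
Variable R : realType.
Implicit Types z w : circle R.

Lemma circle_one_subproof : `|1 : R[i]| == 1.
Proof. by rewrite normr1. Qed.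

Lemma circle_mul_subproof z w : `|circle_val z * circle_val w| == 1.
Proof. by rewrite normrM (eqP (circle_valP z)) (eqP (circle_valP w)) mulr1. Qed.

Lemma circle_inv_subproof z : `|(circle_val z)^-1| == 1.
Proof. by rewrite normfV (eqP (circle_valP z)) invr1. Qed.

Definition circle_zero := Circle circle_one_subproof.
Definition circle_add z w := Circle (circle_mul_subproof z w).
Definition circle_opp z := Circle (circle_inv_subproof z).

Lemma circle_addA : associative circle_add.
Proof. by move=> x y z; apply: val_inj; rewrite /= mulrA. Qed.

Lemma circle_addC : commutative circle_add.
Proof. by move=> x y; apply: val_inj; rewrite /= mulrC. Qed.

Lemma circle_add0 : left_id circle_zero circle_add.
Proof. by move=> x; apply: val_inj; rewrite /= mul1r. Qed.

Lemma circle_addN : left_inverse circle_zero circle_opp circle_add.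
Proof.
move=> x; apply: val_inj => /=; rewrite mulVf// -normr_eq0.
by rewrite (eqP (circle_valP x)) oner_eq0.
Qed.

HB.instance Definition _ := GRing.isZmodule.Build (circle R)
  circle_addA circle_addC circle_add0 circle_addN.

HB.instance Definition _ := Topological.copy (circle R)
  (initial_topology (fun z : circle R => circle_val z : R[i]^o)).

Lemma continuous_circle (T : topologicalType) (f : T -> circle R) :
  continuous f <-> continuous (fun x => circle_val (f x) : R[i]^o).
Proof.
split => [cf x|cf].
  apply: (@continuous_comp T (circle R) (R[i]^o)) (cf x) _.
  exact: (@initial_continuous (circle R) (R[i]^o)).
apply/continuousP => A [B oB <-].
by have /continuousP := cf; apply.
Qed.

Lemma continuous_circleB (T : topologicalType) (f g : T -> circle R) :
  continuous f -> continuous g -> continuous (f - g).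
Proof.
move=> /continuous_circle cf /continuous_circle cg; apply/continuous_circle => x.
apply: (@cvgM (R[i]) T (nbhs x)); first exact: cf.
apply: (@cvgV (R[i]) T (nbhs x)); last exact: cg.
by rewrite -normr_eq0 (eqP (circle_valP (g x))) oner_eq0.
Qed.

End circle_group.

Definition circle_pos (R : realType) : set (circle R) :=
  [set z | 0 <= complex.Re (circle_val z)].

Section expi.
Variable R : realType.

Lemma expi_subproof (t : R) : `|cos t +i* sin t| == 1 :> R[i].
Proof. by rewrite normc_def /= cos2Dsin2 sqrtr1. Qed.

Definition expi (t : R) : circle R := Circle (expi_subproof t).

Lemma expiD (s t : R) : expi (s + t) = expi s + expi t.
Proof.
apply: val_inj; rewrite /= cosD sinD.
by congr (_ +i* _); rewrite addrC.
Qed.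

Lemma continuous_expi : continuous expi.
Proof.
apply/continuous_circle => t; apply/(@cvgrPdist_lt _ (R[i]^o)) => e e0.
have /andP[e1 e2] : (0 < complex.Re e) && (complex.Im e == 0).
  by case: e e0 => a b; rewrite ltcE /= eq_sym andbC.
have h : 0 < complex.Re e / 2 by rewrite divr_gt0.
near=> s.
have -> : e = (complex.Re e / 2 + complex.Re e / 2)%:C.
  by rewrite -splitr; case: (e) e2 => a b /= /eqP ->.
have -> : circle_val (expi t) - circle_val (expi s) =
    (cos t - cos s)%:C + 'i * (sin t - sin s)%:C.
  by apply/eqP; rewrite eq_complex /= !(mul0r, mul1r, subr0, addr0, add0r, mulr0) !eqxx.
rewrite (le_lt_trans (ler_normD _ _))// normrM.
have -> : `|'i : R[i]| = 1 by rewrite normc_def /= expr0n /= expr1n add0r sqrtr1.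
rewrite mul1r !normc_def /= expr0n /= !addr0 !sqrtr_sqr -rmorphD /= ltcR ltrD //.
  near: s; have /cvgrPdist_lt := @continuous_cos R t; exact.
near: s; have /cvgrPdist_lt := @continuous_sin R t; exact.
Unshelve. all: by end_near. Qed.

End expi.

(* A topology on a carrier `G` is a value `tau : Topological G`, so that several
   topologies on one carrier can be compared. *)

Definition coarser (T : Type) (nu tau : Topological T) :=
  @open (Topological.Pack nu) `<=` @open (Topological.Pack tau).

Definition algebraic_characters (R : realType) (G : zmodType) :
  set (G -> circle R) := [set chi : G -> circle R | {morph chi : x y / x + y}].
Arguments algebraic_characters : clear implicits.

Definition characters (R : realType) (G : zmodType) (tau : Topological G) :
    set (G -> circle R) :=
  [set chi : G -> circle R | algebraic_characters R G chi /\
             continuous (chi : Topological.Pack tau -> circle R)].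
Arguments characters R {G} tau _ : assert.

Section dual_group_def.
Variables (R : realType) (G : zmodType) (tau : Topological G).

Definition is_character : {pred G -> circle R} :=
  fun chi => `[< characters R tau chi >].

Lemma is_character_zmod : zmod_closed is_character.
Proof.
split=> [|f g /asboolP[fD fc] /asboolP[gD gc]]; apply/asboolP; split.
- by move=> x y; rewrite [RHS]addr0.
- by move=> x; exact: cvg_cst.
- by move=> x y; rewrite /= [LHS]/(f _ - g _) fD gD opprD addrACA.
- exact: (@continuous_circleB R (Topological.Pack tau)).
Qed.

HB.instance Definition _ :=
  GRing.isZmodClosed.Build (G -> circle R) is_character is_character_zmod.

Record dual_group := Character {
  character_fun :> G -> circle R;
  characterP : character_fun \in is_character }.

HB.instance Definition _ := [isSub for character_fun].
HB.instance Definition _ := [Choice of dual_group by <:].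
HB.instance Definition _ := [SubChoice_isSubZmodule of dual_group by <:].

HB.instance Definition _ := Topological.copy dual_group
  (initial_topology (fun chi : dual_group => chi : {ptws G -> circle R})).

End dual_group_def.
Arguments is_character R {G} tau.
Arguments dual_group R {G} tau.

Section polars.
Variables (R : realType) (G : zmodType) (tau : Topological G).

Definition alg_polar (A : set G) : set (G -> circle R) :=
  [set chi : G -> circle R | algebraic_characters R G chi /\
    forall x, A x -> circle_pos (chi x)].

Definition prepolar (B : set (dual_group R tau)) : set G :=
  [set g | forall chi, B chi -> circle_pos (chi g)].

Definition quasi_convex (A : set G) :=
  forall g, ~ A g -> exists chi : dual_group R tau,
    (forall x, A x -> circle_pos (chi x)) /\ ~ circle_pos (chi g).

Definition group_topology :=
  let T := Topological.Pack tau in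
  continuous (fun x : T * T => (x.1 : G) + x.2 : T) /\
  continuous (fun x : T => - (x : G) : T).

Definition locally_quasi_convex :=
  let T := Topological.Pack tau in
  [/\ group_topology, hausdorff_space T &
      forall U : set T, nbhs ((0 : G) : T) U ->
      exists V : set T,
        [/\ nbhs ((0 : G) : T) V, quasi_convex V & V `<=` U]].

End polars.
Arguments alg_polar R {G} A.
Arguments quasi_convex R {G} tau A.
Arguments locally_quasi_convex R {G} tau.

Definition mackey_group (R : realType) (G : zmodType) (tau : Topological G) :=
  locally_quasi_convex R tau /\
  forall nu : Topological G, locally_quasi_convex R nu ->
    characters R nu = characters R tau -> coarser nu tau.

Definition setsum (V : zmodType) (A B : set V) : set V :=
  [set x + y | x in A & y in B].

(* (n)A for n >= 1; also `A` at the junk value n = 0. *)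
Definition nfold_sum (V : zmodType) (n : nat) (A : set V) : set V :=
  iter n.-1 (fun B => setsum B A) A.

Definition Mac (R : realType) (G : zmodType) (tau : Topological G) :
    set (set (dual_group R tau)) :=
  [set K : set (dual_group R tau) |
    [/\ quasi_convex R (Topological.class (dual_group R tau)) K,
        compact K &
        forall (F : set (dual_group R tau)) (n : nat),
          finite_set F -> F 0 -> (1 <= n)%N ->
          alg_polar R (prepolar (setsum (nfold_sum n K) F))
            `<=` characters R tau]].
Arguments Mac R {G} tau _ : assert.

Section locally_convex.
Variables (R : realType) (E : lmodType R).

Definition lcs_topology (tau : Topological E) :=
  let T := Topological.Pack tau in
  [/\ continuous (fun x : T * T => (x.1 : E) + x.2 : T),
      continuous (fun z : R^o * T => z.1 *: (z.2 : E) : T),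
      exists2 B : set_system E,
        forall b, B b -> convex_set b & @basis T B &
      hausdorff_space T].

Definition continuous_functionals (tau : Topological E) : set (E -> R^o) :=
  [set f : E -> R^o | linear f /\
    continuous (f : Topological.Pack tau -> R^o)].

Definition mackey_space (tau : Topological E) :=
  lcs_topology tau /\
  forall nu : Topological E, lcs_topology nu ->
    continuous_functionals nu = continuous_functionals tau -> coarser nu tau.

End locally_convex.

Section topological_dual.
Variables (R : realType) (E : lmodType R) (tau : Topological E).

Definition is_continuous_functional : {pred E -> R^o} :=
  fun f => `[< continuous_functionals tau f >].

Lemma is_continuous_functional_submod : submod_closed is_continuous_functional.
Proof.
split=> [|a f g /asboolP[fl fc] /asboolP[gl gc]]; apply/asboolP; split.
- by move=> k x y; rewrite /= [RHS]addr0 scaler0.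
- by move=> x; exact: cvg_cst.
- move=> k x y; rewrite /= ![(a *: f + g) _]/(a *: f _ + g _) fl gl.
  by rewrite !scalerDr !scalerA [a * k]mulrC addrACA.
- move=> x; apply: (@cvgD R R^o _ (nbhs (x : Topological.Pack tau)));
    last exact: gc.
  by apply: (@cvgM R _ (nbhs (x : Topological.Pack tau)));
    [exact: cvg_cst|exact: fc].
Qed.

HB.instance Definition _ := GRing.isSubmodClosed.Build R (E -> R^o)
  is_continuous_functional is_continuous_functional_submod.

Record topological_dual := Functional {
  functional_fun :> E -> R^o;
  functionalP : functional_fun \in is_continuous_functional }.

HB.instance Definition _ := [isSub for functional_fun].
HB.instance Definition _ := [Choice of topological_dual by <:].
HB.instance Definition _ := [SubChoice_isSubLmodule of topological_dual by <:].

HB.instance Definition _ := Topological.copy topological_dual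
  (initial_topology (fun f : topological_dual => f : {ptws E -> R^o})).

Lemma psi_subproof (f : topological_dual) :
  (fun x => expi (2 * pi * f x)) \in is_character R tau.
Proof.
have /asboolP[fl fc] := functionalP f.
apply/asboolP; split=> [x y|x].
  by have := fl 1 x y; rewrite !scale1r => ->; rewrite mulrDr expiD.
apply: (@continuous_comp (Topological.Pack tau) R^o (circle R) _ (@expi R)).
  by apply: cvgM; [exact: cvg_cst|exact: fc].
exact: continuous_expi.
Qed.

Definition psi (f : topological_dual) : dual_group R tau :=
  Character (psi_subproof f).

End topological_dual.

Definition absolutely_convex (R : realType) (V : lmodType R) (C : set V) :=
  convex_set C /\
  forall (a : R) (x : V), `|a| <= 1 -> C x -> C (a *: x).

Definition CAC (R : realType) (E : lmodType R) (tau : Topological E) :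
    set (set (topological_dual tau)) :=
  [set C : set (topological_dual tau) |
    [/\ compact C, absolutely_convex C & C !=set0]].
Arguments CAC {R E} tau _ : assert.

Definition swallows (T : Type) (BB AA : set (set T)) :=
  forall A, AA A -> exists2 B, BB B & A `<=` B.

(* Main.v *)
Require Import Defs.
From HB Require Import structures.
From mathcomp Require Import all_boot all_order all_algebra complex.
From mathcomp Require Import all_classical all_reals all_analysis.
From mathcomp Require Import ring lra.

(** Compatible topologies are described by the sets of characters, or of linear
functionals, that they make equicontinuous; the theorem compares the two
descriptions.

For an abelian group and a set [K] in [Mac], the topology of uniform
convergence on [K] and on finite sets is locally quasi-convex and compatible
with the given one ([Mac_topology_lqc], [characters_Mac_topology]): a
homomorphism to the circle that is continuous for it maps the prepolar of some
[((n)K + F)] to the right half plane, and the definition of [Mac] says that it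
is continuous for the given topology. Conversely, the polar of a neighborhood
of [0] for any compatible group topology is in [Mac] ([Mac_polar]). Both
directions rest on the fact that the circle has no small subgroups
([circle_arcP]): a homomorphism that maps a neighborhood of [0] to the right
half plane is continuous ([character_of_nbhs]).

For a locally convex space, the weak* compact absolutely convex sets [C] play
the same role for linear functionals. The topology of uniform convergence on
all of them is locally convex with the same dual ([Mackey_topology_lcs],
[continuous_functionals_Mackey]), by the bipolar theorem ([bipolar]);
conversely, polars of neighborhoods are such sets, by the theorem of Alaoglu
([CAC_equicontinuous]).

The two worlds are linked by two facts. Every continuous character of a locally
convex space is [turn (f x)], that is [psi f], for a continuous linear
functional [f] ([character_lift]), and [f] is bounded by [1/4] on balanced sets
that the character maps to the right half plane ([balanced_bound]). Every
locally convex topology is locally quasi-convex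
([lcs_locally_quasi_convex]), by the theorem of Hahn and Banach.

If the space is a Mackey group, then every locally convex topology with the
same dual has the same characters, hence is coarser. Moreover every [K] in
[Mac] is equicontinuous, hence contained in the polar of an absolutely convex
neighborhood, which is some [psi @` C]. Conversely, let the space be a Mackey
space such that every [K] in [Mac] lies in some [psi @` C]. A quasi-convex
neighborhood of [0] for a compatible topology is the prepolar of its polar [K],
so it contains the set where the elements of [C] are bounded by [1/4], and this
is a neighborhood of [0] for the Mackey topology. *)

Set Implicit Arguments.
Unset Strict Implicit.
Unset Printing Implicit Defensive.

Import Order.TTheory GRing.Theory Num.Theory.
Import numFieldNormedType.Exports.

Local Open Scope classical_set_scope.
Local Open Scope ring_scope.
Local Open Scope complex_scope.

(** * The circle group *)

Section circle_geometry.
Variable R : realType.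
Implicit Types (z w : circle R) (s t e : R).

(** The point at [t] full turns from the neutral element; [psi f x] is
[turn (f x)] by definition. *)
Definition turn t : circle R := expi (2 * pi * t).

Lemma turnD : {morph turn : s t / s + t}.
Proof. by move=> s t; rewrite /turn mulrDr expiD. Qed.

Lemma turn0 : turn 0 = 0.
Proof. by apply: (addrI (turn 0)); rewrite -turnD !addr0. Qed.

Lemma turnN t : turn (- t) = - turn t.
Proof. by apply: (addrI (turn t)); rewrite -turnD !subrr turn0. Qed.

Lemma turnMn t n : turn (t *+ n) = turn t *+ n.
Proof.
by elim: n => [|n ih]; rewrite ?mulr0n ?turn0// !mulrS turnD ih.
Qed.

Lemma turn1 : turn 1 = 0.
Proof.
by apply: val_inj; rewrite /= mulr1 mulr_natl cos2pi sin2pi.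
Qed.

Lemma turnB1 t : turn (t - 1) = turn t.
Proof. by rewrite turnD turnN turn1 subr0. Qed.

Lemma continuous_turn : continuous turn.
Proof.
move=> t; apply: (@continuous_comp _ _ _ (fun t => 2 * pi * t) (@expi R)).
  by apply: cvgM; [exact: cvg_cst|exact: cvg_id].
exact: continuous_expi.
Qed.

Lemma turn_surj z : exists2 t, `|t| <= 1/2 & z = turn t.
Proof.
case: z => -[a b] /= h; have /eqP := h.
rewrite normc_def /= => /(congr1 (@complex.Re R)) /= sab.
have ab : a ^+ 2 + b ^+ 2 = 1.
  by rewrite -[LHS]sqr_sqrtr ?addr_ge0 ?sqr_ge0// sab expr1n.
have a1 : -1 <= a <= 1.
  rewrite -ler_norml -(@ler_pXn2r _ 2) ?nnegrE// expr1n real_normK ?num_real//.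
  by have := sqr_ge0 b; lra.
have pi0 := @pi_gt0 R.
have pu : (2 * @pi R) \is a GRing.unit by rewrite unitfE; lra.
have s0 : 0 <= acos a / (2 * pi) <= 1/2.
  rewrite divr_ge0 ?acos_ge0//=; last by lra.
  by rewrite ler_pdivrMr; [have := acos_lepi a1; lra|lra].
have sb : sin (acos a) = `|b|.
  by rewrite sin_acos// -ab addrC addKr sqrtr_sqr.
have [b0|b0] := leP 0 b.
  exists (acos a / (2 * pi)); first by rewrite ger0_norm; lra.
  apply: val_inj => /=; rewrite [_ * (_ / _)]mulrC divrK//.
  by rewrite acosK ?in_itv// sb ger0_norm.
exists (- (acos a / (2 * pi))); first by rewrite normrN ger0_norm; lra.
apply: val_inj => /=; rewrite mulrN [_ * (_ / _)]mulrC divrK// cosN sinN.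
by rewrite acosK ?in_itv// sb ltr0_norm// opprK.
Qed.

Lemma turn_norm t : cos (2 * pi * t) = cos (2 * pi * `|t|).
Proof.
by case: (leP 0 t) => t0; [rewrite ger0_norm|rewrite ltr0_norm// mulrN cosN].
Qed.

Lemma circle_pos_turn t : `|t| <= 1/2 -> circle_pos (turn t) <-> `|t| <= 1/4.
Proof.
move=> t2; have pi0 := @pi_gt0 R; have t0 := normr_ge0 t.
rewrite /circle_pos /= turn_norm; split => [|t4]; last first.
  by apply: cos_ge0_pihalf; apply/andP; split; nra.
apply: contraTT; rewrite -!ltNge => t4; rewrite -(@cos_pihalf R).
by rewrite ltr_cos; rewrite ?in_itv/=; first nra; apply/andP; split; nra.
Qed.

Lemma turn_eq0 t : `|t| < 1 -> turn t = 0 -> t = 0.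
Proof.
have pi0 := @pi_gt0 R.
have half s : `|s| <= 1/2 -> turn s = 0 -> s = 0.
  move=> s2 /(congr1 (fun z => complex.Re (circle_val z))) /=.
  have s0 := normr_ge0 s; rewrite turn_norm => h1.
  have /eqP : 2 * pi * `|s| = 0.
    by apply: cos_inj; rewrite ?h1 ?cos0// in_itv/=; apply/andP; split; nra.
  rewrite mulf_eq0 normr_eq0 => /orP[|/eqP//].
  by rewrite mulf_eq0 => /orP[] /eqP; lra.
rewrite ltr_norml => /andP[t0 t1].
have [t2|t2] := leP t (1/2); last first.
  have t2' : `|t - 1| <= 1/2 by rewrite ler0_norm; lra.
  by rewrite -turnB1 => /(half _ t2'); lra.
have [t3|t3] := leP (-(1/2)) t; first by apply: half; rewrite ler_norml t3 t2.
have t2' : `|t + 1| <= 1/2 by rewrite ger0_norm; lra.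
by rewrite -(addrK 1 t) turnB1 => /(half _ t2'); lra.
Qed.

(** The closed arc of angular radius [2 * pi * e] around the neutral element.
The arc with [e = 1/4] is the right half of the circle. *)
Definition circle_arc e : set (circle R) :=
  [set z | exists2 t, `|t| <= e & z = turn t].

Lemma circle_arcE z : circle_arc (1/4) z <-> circle_pos z.
Proof.
split=> [[t t4 ->]|]; first by apply/circle_pos_turn; lra.
by have [t t2 ->] := turn_surj z => /(circle_pos_turn t2) t4; exists t.
Qed.

Lemma circle_arc_le e e' : e <= e' -> circle_arc e `<=` circle_arc e'.
Proof. by move=> ee' z [t te ->]; exists t => //; exact: le_trans ee'. Qed.

Lemma circle_arcD e e' z w :
  circle_arc e z -> circle_arc e' w -> circle_arc (e + e') (z + w).
Proof.
move=> [s se ->] [t te ->]; exists (s + t); last by rewrite turnD.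
by rewrite (le_trans (ler_normD _ _))// lerD.
Qed.

Lemma circle_arcN e z : circle_arc e z -> circle_arc e (- z).
Proof. by move=> [s se ->]; exists (- s); rewrite ?normrN ?turnN. Qed.

Lemma circle_arcMn e z n : circle_arc e z -> circle_arc (e *+ n) (z *+ n).
Proof.
by move=> [s se ->]; exists (s *+ n); rewrite ?turnMn// normrMn lerMn2r se orbT.
Qed.

Lemma circle_arc0 e : 0 <= e -> circle_arc e 0.
Proof. by exists 0; rewrite ?normr0 ?turn0. Qed.

(** The circle has no small subgroups, quantitatively: if the first [n.+1]
multiples of [z] stay in the right half plane, then [z] is at most
[1 / 4 / n.+1] turns away from the neutral element. *)
Lemma circle_arc_multiples n z :
  (forall k, (0 < k <= n.+1)%N -> circle_pos (z *+ k)) ->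
  circle_arc (1 / 4 / n.+1%:R) z.
Proof.
have [t t2 ->] := turn_surj z => h; exists t => //.
suff H k : (k <= n)%N -> `|t| <= 1 / 4 / k.+1%:R by exact: H.
elim: k => [_|k ih kn].
  by rewrite divr1; apply/(circle_pos_turn t2); apply: (h 1%N).
have := ih (ltnW kn); rewrite !ler_pdivlMr// !mulr_natr => tk.
have k1 : (1 : R) <= k.+1%:R by rewrite ler1n.
have : `|t| * 1 <= `|t| * k.+1%:R by rewrite ler_wpM2l.
rewrite mulr1 mulr_natr => tk'.
(* By induction [t *+ k.+2] has modulus at most [1/2], and in this range the
   right half plane corresponds to modulus at most [1/4]. *)
have t2' : `|t *+ k.+2| <= 1/2 by rewrite normrMn mulrS; lra.
have := h k.+2 kn; rewrite -turnMn => /(circle_pos_turn t2').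
by rewrite normrMn; lra.
Qed.

Lemma circle_arcP n z : circle_arc (1 / 4 / n.+1%:R) z <->
  forall k, (0 < k <= n.+1)%N -> circle_pos (z *+ k).
Proof.
split=> [h k /andP[_ kn]|]; last exact: circle_arc_multiples.
apply/circle_arcE; apply: circle_arc_le (circle_arcMn k h).
by rewrite -[_ *+ k]mulr_natr mulrAC ler_pdivrMr// ler_wpM2l ?ler_nat//; lra.
Qed.

Lemma hausdorff_circle : hausdorff_space (circle R).
Proof.
move=> z w zw; apply: val_inj.
apply: (@norm_hausdorff (R[i]) (R[i]^o)) => A B Az Bw.
have cv := @initial_continuous (circle R) (R[i]^o) (fun z => circle_val z).
have [x [Ax Bx]] := zw _ _ (cv z _ Az) (cv w _ Bw).
by exists (circle_val x).
Qed.

Lemma compact_turn (a b : R) : compact (turn @` `[a, b]).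
Proof.
apply: continuous_compact; last exact: segment_compact.
by apply: continuous_subspaceT; exact: continuous_turn.
Qed.

Lemma compact_circle : compact [set: circle R].
Proof.
suff -> : [set: circle R] = turn @` `[(-(1/2) : R), 1/2] by exact: compact_turn.
apply/seteqP; split => // z _; have [t t2 ->] := turn_surj z.
by exists t => //=; rewrite in_itv/= -ler_norml.
Qed.

Lemma closed_circle_pos : closed (@circle_pos R).
Proof.
suff -> : @circle_pos R = turn @` `[(-(1/4) : R), 1/4].
  by apply: compact_closed; [exact: hausdorff_circle|exact: compact_turn].
apply/seteqP; split => [z /circle_arcE[t t4 ->]|_ [t /= + <-]].
  by exists t => //=; rewrite in_itv/= -ler_norml.
by rewrite in_itv/= -ler_norml => t4; apply/circle_arcE; exists t.
Qed.

Lemma nbhs_circle_arc e : 0 < e -> nbhs (0 : circle R) (circle_arc e).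
Proof.
(* The complementary arc is compact, hence closed. *)
move=> e0; apply: (@filterS _ _ _ (~` (turn @` `[e, 1 - e]))).
  move=> z; apply: contra_notP; have [t t2 ->] := turn_surj z => te.
  have {}te : e < `|t| by rewrite ltNge; apply/negP => te'; apply: te; exists t.
  have [t0|t0] := leP 0 t.
    move: t2 te; rewrite ger0_norm// => t2 te.
    by exists t => //=; rewrite in_itv/=; apply/andP; split; lra.
  move: t2 te; rewrite ltr0_norm// => t2 te; exists (t + 1).
    by rewrite /= in_itv/=; apply/andP; split; lra.
  by rewrite -turnB1 addrK.
apply: open_nbhs_nbhs; split.
  apply: closed_openC; apply: compact_closed; first exact: hausdorff_circle.
  exact: compact_turn.
move=> [t /=]; rewrite in_itv/= => /andP[et te].
have t1 : `|t| < 1 by rewrite ger0_norm; lra.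
by move/(turn_eq0 t1); lra.
Qed.

Lemma nbhs_circle0 (U : set (circle R)) : nbhs (0 : circle R) U ->
  exists n, circle_arc (1 / 4 / n.+1%:R) `<=` U.
Proof.
move=> U0; have : \forall t \near (0 : R), U (turn t).
  by apply: continuous_turn; rewrite turn0.
rewrite -nbhs_nearE => /nbhs_ballP[e /= e0 He].
have [n ne] : exists n, 1 / 4 / n.+1%:R < e.
  exists (Num.trunc e^-1); rewrite ltr_pdivrMr// -ltr_pdivrMl//.
  have ei0 : 0 < e^-1 by rewrite invr_gt0.
  by have := @truncnS_gt R e^-1; lra.
exists n => z [t tn ->]; apply: He; rewrite /ball/= sub0r normrN.
exact: le_lt_trans ne.
Qed.

Lemma nbhs_circle (z : circle R) (U : set (circle R)) : nbhs z U ->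
  exists n, forall w, circle_arc (1 / 4 / n.+1%:R) (w - z) -> U w.
Proof.
move=> Uz; have c : continuous (fun w : circle R => w - (- z)).
  exact: (@continuous_circleB R (circle R) id (cst (- z)) (fun=> cvg_id)
    (@cst_continuous _ _ _)).
have [] := @nbhs_circle0 (fun w => U (w - (- z))).
  by apply: c; rewrite add0r opprK.
by move=> n h; exists n => w /h; rewrite opprK subrK.
Qed.

Lemma nbhs_circle_translate (z : circle R) e : 0 < e ->
  nbhs z [set w | circle_arc e (w - z)].
Proof.
move=> e0; have c : continuous (fun w : circle R => w - z).
  exact: (@continuous_circleB R (circle R) id (cst z) (fun=> cvg_id)
    (@cst_continuous _ _ _)).
by apply: c; rewrite subrr; exact: nbhs_circle_arc.
Qed.

Lemma cvg_circleD (S : Type) (F : set_system S) (f g : S -> circle R) z w :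
  Filter F -> f @ F --> z -> g @ F --> w -> f s + g s @[s --> F] --> z + w.
Proof.
move=> FF fz gw U /nbhs_circle[n nU].
have e0 : 0 < (1 : R) / 4 / n.+1%:R by rewrite !divr_gt0.
have e0' := divr_gt0 e0 (ltr0Sn R 1).
have fz' : F (f @^-1` [set s | circle_arc (1 / 4 / n.+1%:R / 2) (s - z)]).
  exact: fz (nbhs_circle_translate z e0').
have gw' : F (g @^-1` [set s | circle_arc (1 / 4 / n.+1%:R / 2) (s - w)]).
  exact: gw (nbhs_circle_translate w e0').
suff : F [set s | U (f s + g s)] by [].
apply: (filterS _ (filterI fz' gw')) => s [/= fs gs]; apply: nU.
by rewrite opprD addrACA [X in circle_arc X](splitr _); exact: circle_arcD.
Qed.

End circle_geometry.

(** * Group topologies and characters *)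

(** Neighborhoods for a topology that is not the canonical one of its carrier. *)
Notation nbhs_in tau := (@nbhs _ (Topological.Pack tau)).

Section group_topologies.
Variables (G : zmodType) (tau : Topological G).
Hypothesis gtau : group_topology tau.
Let T : topologicalType := Topological.Pack tau.

Lemma continuous_addl (x : G) : continuous ((fun y => x + y) : T -> T).
Proof.
move=> y; apply: (@continuous_comp T (T * T)%type T (fun y => (x : T, y))
  (fun z : T * T => (z.1 : G) + z.2)); last exact: gtau.1.
by apply: (@cvg_pair _ _ _ _ (nbhs (x : T)) (nbhs (y : T)));
  [exact: cvg_cst|exact: cvg_id].
Qed.

Lemma nbhs_addl (x : G) (U : set G) :
  nbhs_in tau x U <-> nbhs_in tau 0 (fun y => U (x + y)).
Proof.
split => h.
  by apply: (@continuous_addl x (0 : G)); rewrite addr0.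
have := @continuous_addl (- x) x (fun y => U (x + y)).
rewrite addNr => /(_ h); rewrite nbhs_simpl/=.
by congr (nbhs _ _); apply/funext => y; rewrite /= addNKr.
Qed.

Lemma nbhs0_split (U : set G) : nbhs_in tau 0 U ->
  exists2 V : set G, nbhs_in tau 0 V & forall x y, V x -> V y -> U (x + y).
Proof.
have := gtau.1 ((0 : G) : T, (0 : G) : T) U; rewrite /= addr0 => h /h.
move=> [[A B] /= [A0 B0] AB]; exists (A `&` B); first exact: filterI.
by move=> x y [Ax _] [_ By]; apply: (AB (x, y)).
Qed.

Lemma nbhs0_opp (U : set G) :
  nbhs_in tau 0 U -> nbhs_in tau 0 (fun x => U (- x)).
Proof.
by have := gtau.2 (0 : G) U; rewrite oppr0; apply.
Qed.

Lemma nbhs0_muln (U : set G) n : nbhs_in tau 0 U ->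
  nbhs_in tau 0 (fun x => forall k, (k <= n)%N -> U (x *+ k)).
Proof.
elim: n U => [|n ih] U U0.
  apply: filterS (filterT : nbhs_in tau 0 setT) => x _ [|//] _.
  by rewrite mulr0n; exact: nbhs_singleton U0.
have [V V0 VU] := nbhs0_split U0.
apply: (filterS _ (filterI V0 (filterI (ih _ V0) (ih _ U0)))) => x [Vx [Vkx Ux]] k.
rewrite leq_eqVlt => /predU1P[->|]; last exact: Ux.
by rewrite mulrS; apply: VU => //; exact: Vkx.
Qed.

Lemma hausdorff_group :
  (forall x : G, x != 0 -> exists2 U : set G, nbhs_in tau 0 U & ~ U x) ->
  hausdorff_space T.
Proof.
move=> sep p q pq; apply: contrapT => npq.
have /sep[U U0] : (p : G) - q != 0 by rewrite subr_eq0; apply/eqP.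
apply.
have [V V0 VU] := nbhs0_split U0.
have h1 : nbhs_in tau p (fun y => V (- (y - p))).
  apply/nbhs_addl; apply: filterS (nbhs0_opp V0) => y.
  by rewrite addrAC subrr add0r.
have h2 : nbhs_in tau q (fun y => V (y - q)).
  by apply/nbhs_addl; apply: filterS V0 => y; rewrite addrAC subrr add0r.
have [z [z1 z2]] := pq _ _ h1 h2.
by have := VU _ _ z1 z2; rewrite opprB addrA subrK.
Qed.

End group_topologies.

Lemma coarser_nbhs0 (G : zmodType) (nu tau : Topological G) :
  group_topology nu -> group_topology tau ->
  nbhs_in nu 0 `<=` nbhs_in tau 0 -> coarser nu tau.
Proof.
move=> gnu gtau h A; rewrite !openE => oA x Ax.
by apply/(nbhs_addl gtau x)/h/(nbhs_addl gnu x A); exact: oA.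
Qed.

Section characters_of_groups.
Variables (R : realType) (G : zmodType).
Implicit Types (chi : G -> circle R) (tau : Topological G).

Lemma alg_char0 chi : algebraic_characters R G chi -> chi 0 = 0.
Proof. by move=> h; apply: (addrI (chi 0)); rewrite -h !addr0. Qed.

Lemma alg_charN chi : algebraic_characters R G chi -> {morph chi : x / - x}.
Proof.
by move=> h x; apply: (addrI (chi x)); rewrite -h !subrr alg_char0.
Qed.

Lemma alg_charMn chi : algebraic_characters R G chi ->
  forall x n, chi (x *+ n) = chi x *+ n.
Proof.
move=> h x; elim=> [|n ih]; first by rewrite !mulr0n alg_char0.
by rewrite !mulrS h ih.
Qed.

(** A homomorphism to the circle that maps some neighborhood of [0] to the
right half plane is continuous, because the circle has no small subgroups. *)
Lemma character_of_nbhs tau chi (U : set G) : group_topology tau ->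
  algebraic_characters R G chi -> nbhs_in tau 0 U ->
  (forall x, U x -> circle_pos (chi x)) -> characters R tau chi.
Proof.
move=> gtau hchi U0 Uchi; split=> // x V /nbhs_circle[n nV].
apply/(nbhs_addl gtau); apply: filterS (nbhs0_muln gtau n.+1 U0) => y Uy.
apply: nV; rewrite hchi addrAC subrr add0r; apply: circle_arc_multiples.
by move=> k /andP[_ kn]; rewrite -alg_charMn//; apply/Uchi/Uy.
Qed.

(** Conversely, a continuous character is uniformly small near [0]. *)
Lemma character_small tau chi e : characters R tau chi -> 0 < e ->
  nbhs_in tau 0 (fun x => circle_arc e (chi x)).
Proof.
move=> [hchi cchi] e0; apply: (cchi (0 : G)).
by rewrite alg_char0//; exact: nbhs_circle_arc.
Qed.

End characters_of_groups.

(** A base of neighborhoods of [0] for a group topology. *)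
Record group_base (G : zmodType) (N : set_system G) : Prop := GroupBase {
  group_base_ex : N !=set0 ;
  group_baseI : forall U V, N U -> N V -> exists2 W, N W & W `<=` U `&` V ;
  group_base0 : forall U, N U -> U 0 ;
  group_baseD : forall U, N U ->
    exists2 V, N V & forall x y, V x -> V y -> U (x + y) ;
  group_baseN : forall U, N U -> exists2 V, N V & forall x, V x -> U (- x) }.

(** The carrier of the group topology with base [N] at [0]: a copy of [G] that
can bear this topology as its canonical one. *)
Definition based_group (G : zmodType) (N : set_system G)
  (h : group_base N) : Type := G.

Section based_group_topology.
Variables (G : zmodType) (N : set_system G) (h : group_base N).

Definition based_open : set_system (based_group h) :=
  [set A : set G | forall x, A x -> exists2 U, N U & forall y, U y -> A (x + y)].

Lemma based_openT : based_open setT.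
Proof. by move=> x _; have [U NU] := group_base_ex h; exists U. Qed.

Lemma based_openI : setI_closed based_open.
Proof.
move=> A B oA oB x [Ax Bx].
have [U NU UA] := oA x Ax; have [V NV VB] := oB x Bx.
have [W NW WUV] := group_baseI h NU NV.
by exists W => // y /WUV[Uy Vy]; split; [exact: UA|exact: VB].
Qed.

Lemma based_open_bigU (I : Type) (f : I -> set (based_group h)) :
  (forall i, based_open (f i)) -> based_open (\bigcup_i f i).
Proof.
move=> fo x [i _ fix_]; have [U NU Uf] := fo i x fix_.
by exists U => // y Uy; exists i => //; exact: Uf.
Qed.

HB.instance Definition _ := Choice.copy (based_group h) G.
HB.instance Definition _ := isOpenTopological.Build (based_group h)
  based_openT based_openI based_open_bigU.

Definition base_topology : Topological G := Topological.class (based_group h).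

Lemma nbhs_base (x : G) (A : set G) : nbhs_in base_topology x A <->
  exists2 U, N U & forall y, U y -> A (x + y).
Proof.
split=> [|[U NU UA]].
  rewrite nbhsE => -[B [oB Bx] BA]; have [U NU UB] := oB x Bx.
  by exists U => // y Uy; exact/BA/UB.
rewrite nbhsE.
exists [set z | exists2 V, N V & forall y, V y -> A (z + y)]; last first.
  move=> z [V NV VA]; rewrite -(addr0 z); apply: VA; exact: (group_base0 h).
split; last by exists U.
move=> z [V NV VA]; have [W NW WV] := group_baseD h NV.
by exists W => // y Wy; exists W => // y' Wy'; rewrite -addrA; apply/VA/WV.
Qed.

Lemma nbhs0_base (A : set G) : nbhs_in base_topology 0 A <->
  exists2 U, N U & U `<=` A.
Proof.
rewrite nbhs_base; split=> -[U NU UA]; exists U => // y; last first.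
  by rewrite add0r; exact: UA.
by move=> /UA; rewrite add0r.
Qed.

Lemma base_group_topology : group_topology base_topology.
Proof.
split=> [[x y] A /nbhs_base[U NU UA]|x A /nbhs_base[U NU UA]].
  have [V NV VU] := group_baseD h NU.
  exists ((fun z => V (z - x)), (fun z => V (z - y))) => /=.
    by split; apply/nbhs_base; exists V => // z Vz; rewrite addrAC subrr add0r.
  move=> [a b] /= [Va Vb]; have := UA _ (VU _ _ Va Vb).
  by rewrite /= addrACA !subrKC.
have [V NV VU] := group_baseN h NU.
by apply/nbhs_base; exists V => // y /VU/UA; rewrite /= opprD.
Qed.

End based_group_topology.

(** * Pointwise convergence and polars of neighborhoods *)

Section pointwise_convergence.

Lemma cvg_initial (S : choiceType) (T : topologicalType) (f : S -> T)
  (F : set_system S) (s : S) : Filter F ->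
  F --> (s : initial_topology f) <-> f @ F --> f s.
Proof.
move=> FF; split=> [Fs|Fs A].
  exact: (cvg_comp _ _ Fs (@initial_continuous S T f s)).
rewrite nbhsE => -[_ [[B oB <-] Bs] BA].
apply: (filterS BA); apply: Fs; exact: open_nbhs_nbhs.
Qed.

Lemma cvg_ptws (U : Type) (V : topologicalType) (F : set_system (U -> V))
  (f : {ptws U -> V}) : Filter F ->
  F --> f <-> forall x, (fun g : U -> V => g x) @ F --> f x.
Proof.
move=> FF; split=> [Ff x|Ff].
  have /cvg_sup/(_ x) := Ff.
  by move=> /(@cvg_initial {classic _} _ _ _ _ _).
by apply/cvg_sup => x; apply/cvg_initial; exact: Ff.
Qed.

Lemma cvg_initial_ptws (S : choiceType) (U : Type) (V : topologicalType)
  (ev : S -> U -> V) (F : set_system S) (s : S) : Filter F ->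
  F --> (s : initial_topology (ev : S -> {ptws U -> V})) <->
  forall x, (fun g => ev g x) @ F --> ev s x.
Proof.
move=> FF; split=> [/cvg_initial Fs|Fs]; last exact/cvg_initial/cvg_ptws.
by have /cvg_ptws := Fs.
Qed.

(** An ultrafilter that is eventually in a compact set converges there. *)
Lemma ultra_limit (S : Type) (V : topologicalType) (F : set_system S)
  (u : S -> V) (A : set V) : UltraFilter F -> compact A ->
  (\forall s \near F, A (u s)) -> exists2 l, A l & u @ F --> l.
Proof.
move=> UF cA FA; have PF : ProperFilter (u @ F) by exact: fmap_proper_filter.
have [l [Al clFl]] := cA _ PF FA; exists l => // B Bl.
have [//|FB] := in_ultra_setVsetC (u @^-1` B) UF.
by have [z [nBz Bz]] := clFl (~` B) B FB Bl.
Qed.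

End pointwise_convergence.

Lemma is_characterP (R : realType) (G : zmodType) (tau : Topological G)
  (chi : G -> circle R) :
  reflect (characters R tau chi) (chi \in is_character R tau).
Proof. exact: asboolP. Qed.

Section mac.
Variables (R : realType) (G : zmodType).
Implicit Types (tau nu : Topological G).

Lemma cvg_dual_group tau (F : set_system (dual_group R tau))
  (chi : dual_group R tau) : Filter F ->
  F --> chi <-> forall x, (fun g : dual_group R tau => g x) @ F --> chi x.
Proof. exact: cvg_initial_ptws. Qed.

Lemma dual_groupP tau (chi : dual_group R tau) : characters R tau chi.
Proof. exact/is_characterP/characterP. Qed.

Lemma dual_groupMn tau (chi : dual_group R tau) n x :
  (chi *+ n) x = chi x *+ n.
Proof. by elim: n => [//|n ih]; rewrite !mulrS -ih. Qed.

(** The polar of [V] in the dual group of [(G, tau)]. *)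
Definition polar tau (V : set G) : set (dual_group R tau) :=
  [set chi | forall x, V x -> circle_pos (chi x)].

Arguments polar tau V : clear implicits.

(** A version of the theorem of Alaoglu: pointwise limits of homomorphisms are
homomorphisms, and here they are continuous by assumption. *)
Lemma compact_polar tau (V : set G) : alg_polar R V `<=` characters R tau ->
  compact (polar tau V).
Proof.
move=> Vtau; rewrite compact_ultra => F UF FV.
have H x : exists l : circle R, (fun g : dual_group R tau => g x) @ F --> l.
  have [|l _ Fl] := @ultra_limit _ _ F (fun g : dual_group R tau => g x) _ UF
    (@compact_circle R); [exact: filterE|by exists l].
have [phi Fphi] := choice H.
have phiD : algebraic_characters R G phi.
  move=> x y; apply: (cvg_unique (@hausdorff_circle R) _
    (cvg_circleD _ (Fphi x) (Fphi y))).
  have -> : (fun chi : dual_group R tau => chi x + chi y) =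
            (fun chi : dual_group R tau => chi (x + y)) by
    apply/funext => chi; rewrite (dual_groupP chi).1.
  exact: Fphi.
have phiV x : V x -> circle_pos (phi x).
  move=> Vx; apply: (closed_cvg _ (@closed_circle_pos R) _ _ (Fphi x)).
  by apply: filterS FV => chi; apply.
have phic : phi \in is_character R tau by apply/is_characterP/Vtau; split.
by exists (Character phic); split => //; apply/cvg_dual_group.
Qed.

Lemma evaluation_character tau x :
  (fun chi : dual_group R tau => chi x) \in
  is_character R (Topological.class (dual_group R tau)).
Proof.
apply/is_characterP; split=> // chi.
by have /cvg_dual_group := @cvg_id _ (nbhs (chi : dual_group R tau)); exact.
Qed.

Lemma nfold_sum_arc tau (K : set (dual_group R tau)) e x n a :
  (forall psi, K psi -> circle_arc e (psi x)) -> nfold_sum n.+1 K a ->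
  circle_arc (e *+ n.+1) (a x).
Proof.
rewrite /nfold_sum /= => Ke.
elim: n a => [a /Ke//|n ih _ /= [b /ih bK [c /Ke cK <-]]].
by rewrite mulrSr; exact: circle_arcD.
Qed.

Lemma nfold_sum_muln tau (K : set (dual_group R tau)) n psi k :
  K 0 -> K psi -> (k <= n.+1)%N -> nfold_sum n.+1 K (psi *+ k).
Proof.
rewrite /nfold_sum /= => K0 Kpsi; elim: n k => [|n ih] [|k] kn //=.
- by case: k kn.
- by exists 0; [exact: (ih 0%N)|exists 0 => //; rewrite addr0].
- by exists (psi *+ k); [exact: ih|exists psi; rewrite // mulrSr].
Qed.

Lemma filter_mem_seq (T : Type) (I : eqType) (F : set_system T) (s : seq I)
  (P : I -> set T) : Filter F -> (forall i, i \in s -> F (P i)) ->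
  F [set x | forall i, i \in s -> P i x].
Proof.
move=> FF; elim: s => [_|i s ih FP]; first exact: filterE.
have := FP i; rewrite mem_head => /(_ isT) Fi.
have Fs : F [set x | forall i, i \in s -> P i x].
  by apply: ih => j js; apply: FP; rewrite in_cons js orbT.
by apply: (filterS _ (filterI Fi Fs)) => x [Pi Ps] j /predU1P[->|/Ps].
Qed.

(** Polars of neighborhoods of [0] for a compatible group topology belong to
[Mac]. *)
Lemma Mac_polar nu tau (V : set G) : group_topology nu ->
  characters R nu = characters R tau -> nbhs_in nu 0 V ->
  Mac R tau (polar tau V).
Proof.
move=> gnu nutau V0; split.
- move=> chi /existsNP[x /not_implyP[Vx chix]].
  by exists (Character (evaluation_character tau x)); split=> // psi; exact.
- apply: compact_polar => chi [chiD Vchi]; rewrite -nutau.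
  exact: character_of_nbhs Vchi.
- move=> F [//|n] /finite_seqP[s ->] _ _ phi [phiD phiV].
  (* On [W] the elements of the polar are bounded by [1 / 8 / n.+1] turns and
     those of [s] by [1/8], so their sums stay in the right half plane. *)
  pose W := [set x | forall k, (k <= n.+1.*2)%N -> V (x *+ k)] `&`
    [set x | forall chi : dual_group R tau, chi \in s -> circle_arc (1/8) (chi x)].
  rewrite -nutau; apply: (@character_of_nbhs _ _ _ _ W) => //.
    apply: filterI; first exact: nbhs0_muln.
    apply: filter_mem_seq => chi _; apply: character_small; last by lra.
    by rewrite nutau; exact: dual_groupP.
  move=> x [xV xF]; apply: phiV => _ [a aK [b /= bs <-]].
  apply/circle_arcE; have -> : (1/4 : R) = 1 / 4 / n.+1.*2%:R *+ n.+1 + 1/8.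
    rewrite -[X in _ = X + _]mulr_natr -muln2 natrM invfM; field.
    by rewrite nat1r pnatr_eq0.
  apply: circle_arcD; last exact: xF.
  apply: nfold_sum_arc aK => psi Kpsi; rewrite doubleS.
  apply/circle_arcP => k /andP[_ kn].
  by rewrite -(alg_charMn (dual_groupP psi).1); apply/Kpsi/xV; rewrite doubleS.
Qed.

End mac.

(** * The topology attached to a set of characters *)

Section mac_topology.
Variables (R : realType) (G : zmodType) (tau : Topological G).
Hypothesis lqctau : locally_quasi_convex R tau.

Lemma separating_character (x : G) : x != 0 ->
  exists chi : dual_group R tau, ~ circle_pos (chi x).
Proof.
move=> /eqP x0; have [gtau htau qtau] := lqctau; apply: contrapT => /forallNP h.
apply/x0/esym; apply: htau => A B A0 Bx; exists x; split; last first.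
  exact: nbhs_singleton Bx.
have [V [V0 qV VA]] := qtau A A0; apply: VA; apply: contrapT => /qV[chi [_]].
exact: h.
Qed.

Variable K : set (dual_group R tau).
Hypothesis MacK : Mac R tau K.

Let K0 : K 0.
Proof.
have [qK _ _] := MacK; apply: contrapT => /qK[X [_]]; apply.
by rewrite (alg_char0 (dual_groupP X).1); apply/circle_arcE/circle_arc0; lra.
Qed.

(** The elements on which the characters in [K] and in the finite list [s] are
small; these sets form a base at [0] of the topology of uniform convergence
on the sets [K `|` [set` s]], for all finite lists [s]. *)
Definition strip n (s : seq (dual_group R tau)) : set G :=
  [set x | forall chi, K chi \/ chi \in s -> circle_arc (1 / 4 / n.+1%:R) (chi x)].

Definition strips : set_system G := [set U | exists n s, U = strip n s].

Lemma strip_le m n s s' : (m <= n)%N -> {subset s <= s'} ->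
  strip n s' `<=` strip m s.
Proof.
move=> mn ss' x xn chi chiK; apply: circle_arc_le (xn chi _).
  by rewrite ler_pM2l ?lef_pV2 ?posrE ?ler_nat//; lra.
by case: chiK => [|/ss']; [left|right].
Qed.

Lemma strips_base : group_base strips.
Proof.
split.
- by exists (strip 0 [::]), 0%N, [::].
- move=> _ _ [m [s ->]] [n [s' ->]]; exists (strip (maxn m n) (s ++ s')).
    by exists (maxn m n), (s ++ s').
  move=> x xmn; split; apply: strip_le xmn; rewrite ?leq_maxl ?leq_maxr//.
    by move=> chi; rewrite mem_cat => ->.
  by move=> chi; rewrite mem_cat orbC => ->.
- move=> _ [m [s ->]] chi _; rewrite (alg_char0 (dual_groupP chi).1).
  by apply: circle_arc0; rewrite !divr_ge0.
- move=> _ [m [s ->]]; exists (strip m.*2.+1 s); first by exists m.*2.+1, s.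
  move=> x y xm ym chi chiK; rewrite (dual_groupP chi).1.
  have -> : (1 / 4 / m.+1%:R : R) = 1 / 4 / m.*2.+2%:R + 1 / 4 / m.*2.+2%:R.
    by rewrite -doubleS -muln2 natrM; field; rewrite nat1r pnatr_eq0.
  by apply: circle_arcD; [exact: xm|exact: ym].
- move=> _ [m [s ->]]; exists (strip m s); first by exists m, s.
  move=> x xm chi chiK; rewrite (alg_charN (dual_groupP chi).1).
  by apply: circle_arcN; exact: xm.
Qed.

(** The topology of uniform convergence on [K] and on finite sets. *)
Definition Mac_topology : Topological G := base_topology strips_base.

Lemma nbhs_strip n s : nbhs_in Mac_topology 0 (strip n s).
Proof. by apply/nbhs0_base; exists (strip n s) => //; exists n, s. Qed.

(** In particular, [K] is equicontinuous for this topology. *)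
Lemma Mac_topology_polar :
  nbhs_in Mac_topology 0 [set x | forall chi, K chi -> circle_pos (chi x)].
Proof.
apply: filterS (nbhs_strip 0 [::]) => x x0 chi Kchi; apply/circle_arcE.
by have := x0 chi (or_introl Kchi); rewrite divr1.
Qed.

(** The topology is compatible with [tau]. This is what the condition on
[((n)K + F)] in the definition of [Mac] is for: with [F] made of the first few
multiples of the elements of [s], the prepolar of such a set lies in a given
strip. *)
Lemma characters_Mac_topology : characters R Mac_topology = characters R tau.
Proof.
have gnu : group_topology Mac_topology by exact: base_group_topology.
apply/seteqP; split=> [phi phinu|chi tchi]; last first.
  have chiP : chi \in is_character R tau by exact/is_characterP.
  apply: (character_of_nbhs gnu tchi.1 (nbhs_strip 0 [:: Character chiP])).
  move=> x /(_ (Character chiP)); rewrite mem_head divr1 => h.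
  by apply/circle_arcE/h; right.
have e4 : 0 < (1/4 : R) by lra.
have /nbhs0_base[_ [n [s ->]] stripphi] := character_small phinu e4.
have [_ _ hK] := MacK.
pose F := [set` [seq psi *+ k | psi <- 0 :: s, k <- iota 0 n.+2]].
have FP psi k : psi = 0 \/ psi \in s -> (k <= n.+1)%N -> F (psi *+ k).
  move=> psis kn; apply/allpairsP; exists (psi, k); split; last by [].
    by rewrite in_cons; case: psis => [->|->]; rewrite ?eqxx ?orbT.
  by rewrite mem_iota.
have F0 : F 0 by rewrite -[X in F X](mulr0n 0); apply: FP => //; left.
apply: (hK F n.+1 (finite_seq _) F0 isT); split=> [|x xF]; first exact: phinu.1.
apply/circle_arcE/stripphi => chi chiK; apply/circle_arcP => k /andP[_ kn].
rewrite -dual_groupMn; apply: xF; case: chiK => [Kchi|chis].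
  by exists (chi *+ k); [exact: nfold_sum_muln|exists 0; rewrite ?addr0].
exists 0; first by rewrite -(mulr0n chi); exact: (@nfold_sum_muln _ _ _ _ _ 0 0).
by exists (chi *+ k); [apply: FP => //; right|rewrite add0r].
Qed.

Lemma Mac_topology_lqc : locally_quasi_convex R Mac_topology.
Proof.
have gnu : group_topology Mac_topology by exact: base_group_topology.
split=> //.
  apply: hausdorff_group => // x /separating_character[chi chix].
  exists (strip 0 [:: chi]); first exact: nbhs_strip.
  move=> /(_ chi); rewrite mem_head divr1 => h.
  by apply: chix; apply/circle_arcE/h; right.
move=> U /nbhs0_base[_ [n [s ->]] sU]; exists (strip n s).
split=> //; first exact: nbhs_strip.
(* A strip is quasi-convex because it is cut out by the multiples [chi *+ k]
   of the characters that define it. *)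
move=> x /existsNP[chi /not_implyP[chiK /circle_arcP/existsNP]].
move=> [k /not_implyP[kn chix]].
have chikP : ((chi *+ k : dual_group R tau) : G -> circle R) \in
    is_character R Mac_topology.
  by apply/is_characterP; rewrite characters_Mac_topology; exact: dual_groupP.
exists (Character chikP); split=> [y yn|] /=; rewrite dual_groupMn//.
by move/circle_arcP : (yn _ chiK); exact.
Qed.

End mac_topology.

(** * The theorem of Hahn and Banach *)

Section hahn_banach.
Variables (R : realType) (E : lmodType R).
Implicit Types (p q : E -> R) (x y : E).

(** Subadditive and positively homogeneous; for the latter, [<=] suffices. *)
Definition sublinear p := (forall x y, p (x + y) <= p x + p y) /\
  forall t x, 0 <= t -> p (t *: x) <= t * p x.

Lemma sublinear0 p : sublinear p -> p 0 = 0.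
Proof.
move=> [pD pZ]; apply/eqP; rewrite eq_le; apply/andP; split.
  by rewrite -(scale0r (0 : E)) (le_trans (pZ _ _ (lexx 0)))// mul0r.
by have := pD 0 0; rewrite addr0; lra.
Qed.

Lemma sublinearZ p t x : sublinear p -> 0 <= t -> p (t *: x) = t * p x.
Proof.
move=> sp; rewrite le_eqVlt => /predU1P[<-|t0].
  by rewrite scale0r mul0r sublinear0.
apply/eqP; rewrite eq_le (sp.2 _ _ (ltW t0))/= -ler_pdivlMl//.
have ti0 : 0 <= t^-1 by rewrite invr_ge0 ltW.
by have := sp.2 t^-1 (t *: x) ti0; rewrite scalerA mulVf ?scale1r// gt_eqF.
Qed.

Lemma sublinear_opp p x : sublinear p -> - p (- x) <= p x.
Proof.
by move=> sp; have := sp.1 x (- x); rewrite subrr sublinear0//; lra.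
Qed.

Let slopes p y x : set R := [set p (x + t *: y) - t * p y | t in [set t | 0 <= t]].
(** The largest sublinear functional [q] below [p] with [q (- y) = - p y]. *)
Let flatten p y x := inf (slopes p y x).

Let slopes_inf p y x : sublinear p -> has_inf (slopes p y x).
Proof.
move=> sp; split; first by exists (p (x + 0 *: y) - 0 * p y); exists 0 => /=.
exists (- p (- x)) => _ [t /= t0 <-]; rewrite -sublinearZ//.
have := sp.1 (x + t *: y) (- x).
by rewrite addrAC subrr add0r; lra.
Qed.

Let flatten_le p y x t : sublinear p -> 0 <= t ->
  flatten p y x <= p (x + t *: y) - t * p y.
Proof. by move=> sp t0; apply: ge_inf; [exact: (slopes_inf _ _ sp).2|exists t]. Qed.

Let le_flatten p y x c : sublinear p ->
  (forall t, 0 <= t -> c <= p (x + t *: y) - t * p y) -> c <= flatten p y x.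
Proof.
move=> sp h; apply: lb_le_inf; first exact: (slopes_inf _ _ sp).1.
by move=> _ [t /= t0 <-]; exact: h.
Qed.

Let flatten_sublinear p y : sublinear p -> sublinear (flatten p y).
Proof.
move=> sp; split=> [x x'|t x].
  rewrite -lerBlDr; apply: le_flatten => // t t0.
  rewrite lerBlDr [leRHS]addrC -lerBlDr; apply: le_flatten => // s s0.
  rewrite lerBlDr.
  have /le_trans := @flatten_le p y (x + x') (s + t) sp (addr_ge0 s0 t0); apply.
  have := sp.1 (x' + s *: y) (x + t *: y).
  rewrite scalerDl addrACA [x' + x]addrC mulrDl; lra.
rewrite le_eqVlt => /predU1P[<-|t0].
  rewrite scale0r mul0r; have := @flatten_le p y 0 0 sp (lexx _).
  by rewrite scale0r addr0 mul0r subr0 (sublinear0 sp).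
rewrite -ler_pdivrMl//; apply: le_flatten => // s s0.
rewrite ler_pdivrMl//.
have /le_trans := @flatten_le p y (t *: x) (t * s) sp (mulr_ge0 (ltW t0) s0); apply.
by rewrite -scalerA -scalerDr sublinearZ ?(ltW t0)// mulrBr mulrA.
Qed.

(** Zorn's lemma applies because the pointwise infimum of a chain of sublinear
functionals is sublinear; it is finite, [- p (- x)] being a lower bound. *)
Lemma minimal_sublinear p : sublinear p -> exists q,
  [/\ sublinear q, (forall x, q x <= p x) &
      forall q', sublinear q' -> (forall x, q' x <= q x) -> q' = q].
Proof.
move=> sp; pose T := {q | sublinear q /\ forall x, q x <= p x}.
pose r (q q' : T) := `[< forall x, sval q' x <= sval q x >].
have [| | |A Atot|q0 q0max] := @Zorn T r.
- by move=> q; apply/asboolP.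
- move=> q1 q2 q3 /asboolP h1 /asboolP h2; apply/asboolP => x.
  exact: le_trans (h1 x).
- move=> [q1 h1] [q2 h2] /asboolP /= h12 /asboolP /= h21.
  have e : q1 = q2 by apply/funext => x; apply/eqP; rewrite eq_le h12 h21.
  by subst q2; congr exist; exact: Prop_irrelevance.
- have [[q1 Aq1]|/forallNP A0] := pselect (exists q : T, A q); last first.
    have pp : sublinear p /\ forall x, p x <= p x by [].
    by exists (exist _ p pp) => q /A0.
  pose vals x : set R := [set sval (q : T) x | q in A].
  pose m x := inf (vals x).
  have hinf x : has_inf (vals x).
    split; first by exists (sval q1 x), q1.
    exists (- p (- x)) => _ [q Aq <-]; have [sq qp] := svalP q.
    by apply: le_trans (sublinear_opp x sq); rewrite lerN2.
  have mle (q : T) x : A q -> m x <= sval q x.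
    by move=> Aq; apply: ge_inf; [exact: (hinf x).2|exists q].
  have lem c x : (forall q : T, A q -> c <= sval q x) -> c <= m x.
    by move=> h; apply: lb_le_inf; [exact: (hinf x).1|move=> _ [q Aq <-]; exact: h].
  have sm : sublinear m /\ forall x, m x <= p x.
    split; last by move=> x; apply: le_trans (mle _ _ Aq1) _; exact: (svalP q1).2.
    split=> [x y|t x t0].
      rewrite -lerBlDr; apply: (lem _ x) => q Aq.
      rewrite lerBlDr [leRHS]addrC -lerBlDr.
      apply: lem => q' Aq'; rewrite lerBlDr.
      have [/asboolP qq'|/asboolP qq'] := Atot _ _ Aq Aq'.
        apply: le_trans (mle _ _ Aq') _; apply: le_trans ((svalP q').1.1 _ _) _.
        by rewrite addrC lerD2l.
      apply: le_trans (mle _ _ Aq) _; apply: le_trans ((svalP q).1.1 _ _) _.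
      by rewrite addrC lerD2r.
    move: t0; rewrite le_eqVlt => /predU1P[<-|t0].
      rewrite scale0r mul0r; apply: le_trans (mle _ _ Aq1) _.
      by rewrite sublinear0//; exact: (svalP q1).1.
    rewrite -ler_pdivrMl//; apply: lem => q Aq; rewrite ler_pdivrMl//.
    by apply: le_trans (mle _ _ Aq) _; apply: (svalP q).1.2; exact: ltW.
  by exists (exist _ m sm) => q Aq; apply/asboolP => x /=; exact: mle.
have [sq qp] := svalP q0; exists (sval q0); split=> // q' sq' q'q.
have hq' : sublinear q' /\ forall x, q' x <= p x.
  by split=> // x; exact: le_trans (qp x).
by rewrite -(q0max (exist _ q' hq'))//; apply/asboolP.
Qed.

(** The theorem of Hahn and Banach. A minimal sublinear functional [f] is equal
to its own flattening in every direction, and this makes it linear. Taking [f]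
below the flattening of [p] in the direction [x] ensures that [f x = p x]. *)
Theorem hahn_banach p x : sublinear p -> exists f : E -> R^o,
  [/\ linear f, forall y, f y <= p y & f x = p x].
Proof.
move=> sp; have sp' := flatten_sublinear x sp.
have [f [sf fp' fmin]] := minimal_sublinear sp'.
have fD y z : f (y + z) = f y + f z.
  apply/eqP; rewrite eq_le sf.1/= -lerBrDr.
  have ffz : flatten f z = f.
    apply: fmin; first exact: flatten_sublinear.
    move=> u; have := @flatten_le f z u 0 sf (lexx _).
    by rewrite scale0r addr0 mul0r subr0.
  by have := @flatten_le f z y 1 sf ler01; rewrite ffz scale1r mul1r.
have f0 := sublinear0 sf.
have fN y : f (- y) = - f y.
  by apply/eqP; rewrite -addr_eq0 -fD addNr f0.
have fp y : f y <= p y.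
  apply: le_trans (fp' y) _.
  by have := @flatten_le p x y 0 sp (lexx _); rewrite scale0r addr0 mul0r subr0.
exists f; split=> //.
  move=> t y z; rewrite fD; congr (_ + _).
  have [t0|t0] := leP 0 t; first exact: sublinearZ.
  rewrite -[t in LHS]opprK scaleNr fN sublinearZ ?oppr_ge0 ?(ltW t0)//.
  by rewrite mulNr opprK.
apply/eqP; rewrite eq_le fp/= -lerN2 -fN; apply: le_trans (fp' _) _.
have := @flatten_le p x (- x) 1 sp ler01.
by rewrite scale1r addNr mul1r (sublinear0 sp) sub0r.
Qed.

End hahn_banach.

(** * Convexity and locally convex topologies *)

Section convexity.
Variables (R : realType) (E : lmodType R).
Implicit Types (A W : set E) (x y : E).

Lemma convex_setP A : convex_set A <->
  forall x y (t : R), 0 <= t <= 1 -> A x -> A y -> A (t *: x + (1 - t) *: y).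
Proof.
split=> [cA x y t /andP[t0 t1] /mem_set Ax /mem_set Ay|cA x y t].
  by have /set_mem := cA x y (Itv01 t0 t1) Ax Ay.
by move=> /set_mem Ax /set_mem Ay; apply/mem_set; apply: cA => //; rewrite ge0 le1.
Qed.

Lemma absolutely_convex0 A : absolutely_convex A -> A !=set0 -> A 0.
Proof. by move=> [_ h] [x Ax]; rewrite -(scale0r x); apply: h; rewrite ?normr0. Qed.

(** [W] contains a positive multiple of every vector. For absolutely convex
sets this is the usual notion. *)
Definition absorbing W := forall x, exists2 d : R, 0 < d & W (d *: x).

(** The Minkowski functional of [W]. *)
Definition gauge W x : R := inf [set t : R | 0 < t /\ W (t^-1 *: x)].

Variable W : set E.
Hypotheses (aW : absolutely_convex W) (bW : absorbing W).

Let inf_gauge x : has_inf [set t : R | 0 < t /\ W (t^-1 *: x)].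
Proof.
split; last by exists 0 => t [/ltW].
have [d d0 Wd] := bW x.
by exists d^-1; split; rewrite ?invr_gt0 ?invrK.
Qed.

Lemma gauge_le x t : 0 < t -> W (t^-1 *: x) -> gauge W x <= t.
Proof. by move=> t0 Wt; apply: ge_inf => //; exact: (inf_gauge x).2. Qed.

Lemma le_gauge x c : (forall t, 0 < t -> W (t^-1 *: x) -> c <= t) ->
  c <= gauge W x.
Proof.
by move=> h; apply: lb_le_inf; [exact: (inf_gauge x).1|move=> t [t0 Wt]; exact: h].
Qed.

Lemma gauge_sublinear : sublinear (gauge W).
Proof.
split=> [x y|t x].
  rewrite -lerBlDr; apply: le_gauge => s s0 Ws.
  rewrite lerBlDr [leRHS]addrC -lerBlDr; apply: le_gauge => t t0 Wt.
  rewrite lerBlDr; have st0 : 0 < t + s by rewrite addr_gt0.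
  apply: gauge_le => //.
  have -> : (t + s)^-1 *: (x + y) =
    (s / (t + s)) *: (s^-1 *: x) + (1 - s / (t + s)) *: (t^-1 *: y).
    have -> : 1 - s / (t + s) = t / (t + s) by field; rewrite gt_eqF.
    by rewrite !scalerA scalerDr; congr (_ *: _ + _ *: _); field; rewrite ?gt_eqF.
  have /convex_setP cW := aW.1; apply: cW => //.
  by rewrite (divr_ge0 (ltW s0) (ltW st0))/= ler_pdivrMr// mul1r lerDr ltW.
rewrite le_eqVlt => /predU1P[<-|t0].
  rewrite scale0r mul0r; apply/ler_addgt0Pr => e e0; rewrite add0r.
  apply: gauge_le => //; rewrite scaler0; apply: absolutely_convex0 => //.
  by have [d _ Wd] := bW 0; exists (d *: 0).
rewrite -ler_pdivrMl//; apply: le_gauge => s s0 Ws; rewrite ler_pdivrMl//.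
apply: gauge_le; first by rewrite mulr_gt0.
by rewrite scalerA invfM -mulrA mulrC -mulrA divff ?mulr1// gt_eqF.
Qed.

Lemma gauge_le1 x : W x -> gauge W x <= 1.
Proof. by move=> Wx; apply: gauge_le => //; rewrite invr1 scale1r. Qed.

Lemma gauge_ge1 x : ~ W x -> 1 <= gauge W x.
Proof.
move=> Wx; apply: le_gauge => t t0 Wt; rewrite leNgt; apply/negP => t1; apply: Wx.
have -> : x = t *: (t^-1 *: x) by rewrite scalerA divff ?scale1r// gt_eqF.
by apply: aW.2 => //; rewrite ger0_norm ltW.
Qed.

End convexity.

Lemma linear_facts (R : realType) (E : lmodType R) (f : E -> R^o) :
  linear f ->
  [/\ f 0 = 0, {morph f : x y / x + y} & forall t x, f (t *: x) = t * f x].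
Proof.
move=> fl.
have fD : {morph f : u v / u + v} by move=> u v; have := fl 1 u v; rewrite !scale1r.
have f0 : f 0 = 0 by apply: (addrI (f 0)); rewrite -fD !addr0.
by split=> // t u; have := fl t u 0; rewrite !addr0 f0 addr0.
Qed.

Section lcs_topologies.
Variables (R : realType) (E : lmodType R) (tau : Topological E).
Hypothesis ltau : lcs_topology tau.
Let T : topologicalType := Topological.Pack tau.

Lemma continuous_scale_at (t : R) (x : E) (U : set E) :
  nbhs_in tau (t *: x) U -> exists A B, [/\ nbhs (t : R^o) A, nbhs_in tau x B &
    forall s y, A s -> B y -> U (s *: y)].
Proof.
have [_ cs _ _] := ltau => /(cs ((t : R^o), (x : T)))[[A B] /= [nA nB] AB].
by exists A, B; split=> // s y As By; exact: (AB (s, y)).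
Qed.

Lemma lcs_group : group_topology tau.
Proof.
split; first by have [] := ltau.
move=> x U; rewrite -scaleN1r => /continuous_scale_at[A [B [nA nB AB]]].
apply: filterS nB => y By; rewrite /= -scaleN1r; apply: AB => //.
exact: nbhs_singleton.
Qed.

Lemma nbhs0_scale t (U : set E) :
  nbhs_in tau 0 U -> nbhs_in tau 0 (fun x => U (t *: x)).
Proof.
move=> U0; have := U0; rewrite -{1}(scaler0 _ t).
move=> /continuous_scale_at[A [B [nA nB AB]]].
by apply: filterS nB => y By; apply: AB => //; exact: nbhs_singleton.
Qed.

Lemma nbhs0_absorbs (U : set E) x : nbhs_in tau 0 U ->
  exists2 d : R, 0 < d & forall s : R, `|s| < d -> U (s *: x).
Proof.
move=> U0; have := U0; rewrite -{1}(scale0r x).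
move=> /continuous_scale_at[A [B [nA nB AB]]].
move: nA => /nbhs_ballP[d /= d0 dA]; exists d => // s sd.
apply: AB; last exact: nbhs_singleton nB.
by apply: dA; rewrite /ball/= sub0r normrN.
Qed.

Lemma nbhs0_absorbing (U : set E) : nbhs_in tau 0 U -> absorbing U.
Proof.
move=> U0 x; have [d d0 dU] := nbhs0_absorbs x U0.
by exists (d / 2); [rewrite divr_gt0|apply: dU; rewrite ger0_norm; lra].
Qed.

Lemma lcs_abs_convex (U : set E) : nbhs_in tau 0 U ->
  exists W : set E, [/\ nbhs_in tau 0 W, absolutely_convex W & W `<=` U].
Proof.
have [_ _ [B Bconv [Bo Bb]] _] := ltau => /Bb[b [Bb' b0] bU].
have nb : nbhs_in tau 0 b by apply: open_nbhs_nbhs; split=> //; exact: Bo.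
have /convex_setP cb := Bconv _ Bb'.
exists (b `&` (fun x => b (- x))); split.
- by apply: filterI => //; exact: nbhs0_opp lcs_group _ nb.
- have sym a x : `|a| <= 1 -> b x -> b (- x) -> b (a *: x).
    rewrite ler_norml => /andP[a0 a1] bx bNx.
    have -> : a *: x = ((1 + a) / 2) *: x + (1 - (1 + a) / 2) *: (- x).
      by rewrite scalerN -scaleNr -scalerDl; congr (_ *: _); field.
    by apply: cb => //; apply/andP; split; lra.
  split=> [|a x a1 [bx bNx]].
    apply/convex_setP => x y t t01 [bx bNx] [by_ bNy]; split; first exact: cb.
    by rewrite opprD -!scalerN; exact: cb.
  by split; rewrite -?scaleNr; apply: sym => //; rewrite normrN.
- by move=> x [/bU].
Qed.

Lemma functional_continuous (f : E -> R^o) (W : set E) c : linear f ->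
  nbhs_in tau 0 W -> (forall x, W x -> `|f x| <= c) -> continuous_functionals tau f.
Proof.
move=> fl W0 fW; split=> // x; apply/cvgrPdist_lt => e e0.
pose k := `|c| + 1.
have k0 : 0 < k by rewrite ltr_wpDl.
apply/(nbhs_addl lcs_group); apply: filterS (nbhs0_scale (k / e) W0) => y /fW fy.
have [_ fD fZ] := linear_facts fl.
rewrite fD opprD addrA subrr add0r normrN.
move: fy; rewrite fZ normrM (ger0_norm (divr_ge0 (ltW k0) (ltW e0))).
rewrite mulrAC ler_pdivrMr// => fy.
have ck : c * e < k * e by rewrite ltr_pM2r// /k; have := ler_norm c; lra.
by rewrite -(ltr_pM2l k0); lra.
Qed.

Lemma functional_bounded (f : E -> R^o) e : continuous_functionals tau f -> 0 < e ->
  nbhs_in tau 0 (fun x => `|f x| <= e).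
Proof.
move=> [fl cf] e0; have /cvgrPdist_le/(_ e e0) := cf (0 : E).
apply: filterS => x /=.
have -> : f 0 = 0 by have := fl (-1) 0 0; rewrite scaleN1r addNr scaleN1r addNr.
by rewrite sub0r normrN.
Qed.

End lcs_topologies.

(** * Characters of locally convex spaces *)

Section lifting.
Variables (R : realType).

(** For [`|a| > 1/4] some [s * a] with [s] in the unit interval is sent by
[turn] outside of the right half plane. *)
Lemma rescale (a : R) : 1/4 < `|a| ->
  exists s, [/\ 0 <= s <= 1, 1/4 < `|s * a| & `|s * a| <= 1/2].
Proof.
move=> a4; have [a2|a2] := leP `|a| (1/2).
  by exists 1; rewrite (mul1r a) ler01 lexx; split.
have a0 : 0 < `|a| by lra.
have ai : (1/2 / `|a|) * `|a| = 1/2 by rewrite mulfVK// gt_eqF.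
exists (1/2 / `|a|).
by rewrite ler_pdivrMr// divr_ge0// normrM ger0_norm ?divr_ge0// ai; split; lra.
Qed.

Lemma turn_scale_inj (a b : R) : (forall t, turn (a * t) = turn (b * t)) -> a = b.
Proof.
move=> ab; apply/eqP; rewrite -subr_eq0; apply/negPn/negP => c0.
have h : turn ((a - b) * ((a - b)^-1 / 2)) = 0.
  by rewrite mulrBl turnD turnN ab subrr.
have : 2^-1 = 0 :> R.
  by apply: turn_eq0; [rewrite ger0_norm; lra|rewrite -h mulrA divff// mul1r].
lra.
Qed.

(** The continuous homomorphisms from the real line to the circle. The value of
[gamma] at some small [d] determines those at all [d / n], hence at all
rational multiples of [d]. *)
Lemma line_character (gamma : R -> circle R) : {morph gamma : s t / s + t} ->
  (forall e, 0 < e -> exists2 d, 0 < d &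
    forall s, `|s| < d -> circle_arc e (gamma s)) ->
  exists a, forall t, gamma t = turn (a * t).
Proof.
move=> gD gs; have galg : algebraic_characters R R gamma by [].
have [d0 d00 dg] := gs (1/4) ltac:(lra).
pose d := d0 / 2; have d_gt0 : 0 < d by rewrite divr_gt0.
have {}dg s : `|s| <= d -> circle_arc (1/4) (gamma s).
  by move=> sd; apply: dg; rewrite /d in sd; lra.
have [th th4 gth] : circle_arc (1/4) (gamma d) by apply: dg; rewrite gtr0_norm.
have gdn n : gamma (d / n.+1%:R) = turn (th / n.+1%:R).
  have n0 : 0 < n.+1%:R :> R by [].
  have [s sn gsn] : circle_arc (1 / 4 / n.+1%:R) (gamma (d / n.+1%:R)).
    apply: circle_arc_multiples => k /andP[_ kn].
    rewrite -(alg_charMn galg); apply/circle_arcE/dg.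
    rewrite normrMn (ger0_norm (ltW (divr_gt0 d_gt0 n0))).
    by rewrite -[_ *+ k]mulr_natr mulrAC ler_pdivrMr// ler_pM2l// ler_nat.
  have e : turn (s * n.+1%:R) = turn th.
    rewrite -gth mulr_natr turnMn -gsn -(alg_charMn galg) -[_ *+ n.+1]mulr_natr.
    by rewrite mulfVK// gt_eqF.
  have sn4 : `|s * n.+1%:R| <= 1/4.
    by rewrite normrM (ger0_norm (ltW n0)) -ler_pdivlMr.
  have : s * n.+1%:R - th = 0.
    apply: turn_eq0; last by rewrite turnD turnN e subrr.
    by have := ler_normB (s * n.+1%:R) th; lra.
  by move/eqP; rewrite subr_eq0 => /eqP <-; rewrite mulfK// gt_eqF.
exists (th / d) => t.
(* [delta] is a homomorphism, small near [0], that vanishes at all [d / n]: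
   subtracting a multiple of [d / n] moves every [t] close to [0]. *)
pose delta t := gamma t - turn (th / d * t).
have deltaD : algebraic_characters R R delta.
  by move=> x y; rewrite /delta gD mulrDr turnD opprD addrACA.
have delta0 n : delta (d / n.+1%:R) = 0.
  by rewrite /delta gdn mulrA mulfVK ?gt_eqF// subrr.
have deltaz x (k : int) : delta x = 0 -> delta (x *~ k) = 0.
  move=> dx; case: k => k; first by rewrite (alg_charMn deltaD) dx mul0rn.
  by rewrite NegzE mulrNz (alg_charN deltaD) (alg_charMn deltaD) dx mul0rn oppr0.
suff arcs e : 0 < e -> circle_arc e (delta t).
  have [s s2 ds] := turn_surj (delta t).
  have [s0|s0] := eqVneq s 0.
    by move: ds; rewrite s0 turn0 => /eqP; rewrite subr_eq0 => /eqP.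
  have s_gt0 : 0 < `|s| / 2 by rewrite divr_gt0// normr_gt0.
  have [s' s's ds'] := arcs _ s_gt0.
  have ss' : s - s' = 0.
    apply: turn_eq0; last by rewrite turnD turnN -ds -ds' subrr.
    by have := ler_normB s s'; lra.
  have ssn : `|s| = `|s'| by congr (`|_|); lra.
  by exfalso; lra.
move=> e0; have e2 : 0 < e / 2 by rewrite divr_gt0.
have [d1 d10 d1g] := gs _ e2.
have [d2 d20 d2g] : exists2 d2 : R, 0 < d2 &
    forall s, `|s| < d2 -> circle_arc (e / 2) (turn (th / d * s)).
  exists (e / 2 / (`|th / d| + 1)); first by rewrite divr_gt0// ltr_wpDl.
  move=> s; rewrite ltr_pdivlMr ?ltr_wpDl// => se; exists (th / d * s) => //.
  by rewrite normrM; have := normr_ge0 s; lra.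
have dm : 0 < Num.min d1 d2 by rewrite lt_min d10.
pose n := Num.trunc (d / Num.min d1 d2).
have n0 : 0 < n.+1%:R :> R by [].
have dn : d / n.+1%:R < Num.min d1 d2.
  by rewrite ltr_pdivrMr// mulrC -ltr_pdivrMr//; exact: truncnS_gt.
have dn0 : 0 < d / n.+1%:R by rewrite divr_gt0.
pose k := Num.floor (t / (d / n.+1%:R)); pose r := t - (d / n.+1%:R) *~ k.
have /andP[r0 rd] : 0 <= r < d / n.+1%:R.
  rewrite /r -mulrzr subr_ge0 ltrBlDr mulrC -ler_pdivlMr// floor_le/=.
  have := floorD1_gt (t / (d / n.+1%:R)).
  by rewrite intrD ltr_pdivrMr// mulrDl mul1r addrC.
have -> : delta t = delta r.
  by rewrite /r deltaD (alg_charN deltaD) deltaz ?oppr0 ?addr0.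
move: dn; rewrite lt_min => /andP[dn1 dn2].
rewrite [e]splitr; apply: circle_arcD.
  by apply: d1g; rewrite ger0_norm// (lt_trans rd).
by apply: circle_arcN; apply: d2g; rewrite ger0_norm// (lt_trans rd).
Qed.

End lifting.

Section characters_of_lcs.
Variables (R : realType) (E : lmodType R) (tau : Topological E).
Hypothesis ltau : lcs_topology tau.

(** If [turn (f x)] stays in the right half plane for [x] in a balanced set,
then [f] itself does not leave the interval of radius [1/4], for otherwise a
smaller multiple of [f x] would lie just outside of this interval. *)
Lemma balanced_bound (f : E -> R^o) (W : set E) : linear f ->
  (forall (a : R) x, `|a| <= 1 -> W x -> W (a *: x)) ->
  (forall x, W x -> circle_pos (turn (f x))) -> forall x, W x -> `|f x| <= 1/4.
Proof.
move=> /linear_facts[_ _ fZ] bW fW x Wx; rewrite leNgt; apply/negP => /rescale[s].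
case=> /andP[s0 s1] sf4 sf2; have := fW (s *: x); rewrite fZ => h.
have /(circle_pos_turn sf2) : circle_pos (turn (s * f x)).
  by apply/h/bW => //; rewrite ger0_norm.
lra.
Qed.

Lemma turn_functional (nu : Topological E) (f : E -> R^o) :
  continuous_functionals nu f -> characters R nu (fun x => turn (f x)).
Proof.
move=> [/linear_facts[_ fD _] fc]; split=> [x y|x]; first by rewrite fD turnD.
apply: (@continuous_comp (Topological.Pack nu) R^o (circle R)); first exact: fc.
exact: continuous_turn.
Qed.

(** Every continuous character of a locally convex space lifts to a continuous
linear functional: it does so along each line, and the lifts along lines fit
together because they are unique. *)
Lemma character_lift (chi : E -> circle R) : characters R tau chi ->
  exists2 f : E -> R^o, continuous_functionals tau f & chi = (fun x => turn (f x)).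
Proof.
move=> chic; have [chiD _] := chic.
have line x : exists a : R^o, forall t : R, chi (t *: x) = turn (a * t).
  apply: line_character => [s t|e e0]; first by rewrite scalerDl chiD.
  have [d d0 dU] := nbhs0_absorbs ltau x (character_small chic e0).
  by exists d.
have [f fchi] := choice line.
have fl : linear f.
  move=> k x y; apply: turn_scale_inj => t.
  rewrite -fchi scalerDr chiD scalerA !fchi -turnD; congr turn.
  by rewrite [RHS](_ : _ = (k * f x + f y) * t)//; ring.
have chif x : chi x = turn (f x) by rewrite -{1}(scale1r x) fchi mulr1.
exists f; last exact/funext.
have e4 : 0 < (1/4 : R) by lra.
have [W [W0 aW WU]] := lcs_abs_convex ltau (character_small chic e4).
apply: (functional_continuous ltau fl W0).
apply: balanced_bound => //; first exact: aW.2.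
by move=> x /WU; rewrite /= chif => /circle_arcE.
Qed.

(** The bipolar [V] of an absolutely convex neighborhood [W] of [0] is
quasi-convex, and Hahn-Banach, applied to the Minkowski functional of [W],
shows that it is contained in twice [W]. *)
Lemma lcs_locally_quasi_convex : locally_quasi_convex R tau.
Proof.
have gtau := lcs_group ltau.
split=> //; first by have [] := ltau.
move=> U U0; have [W [W0 aW WU]] := lcs_abs_convex ltau (nbhs0_scale ltau 2 U0).
pose V := [set x : E | forall f, continuous_functionals tau f ->
  (forall y, W y -> `|f y| <= 1/4) -> `|f x| <= 1/4].
have V0 : nbhs_in tau 0 V by apply: filterS W0 => x Wx f _; exact.
exists V; split=> //.
  move=> x /existsNP[f /not_implyP[fc /not_implyP[fW /negP]]].
  rewrite -ltNge => /rescale[s [/andP[s0 s1] sf4 sf2]].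
  have [_ fD fZ] := linear_facts fc.1.
  have sfV y : V y -> `|s * f y| <= 1/4.
    move=> /(_ f fc fW) fy; rewrite normrM ger0_norm//.
    by apply: le_trans fy; rewrite ler_piMl.
  have sfl : linear (fun y => s * f y : R^o).
    by move=> k u v; rewrite fD fZ /= mulrDr mulrCA.
  have sfc : continuous_functionals tau (fun y => s * f y : R^o).
    exact: (functional_continuous ltau sfl V0 sfV).
  have chiP : (fun y => turn (s * f y)) \in is_character R tau.
    by apply/is_characterP; exact: turn_functional sfc.
  exists (Character chiP); split=> [y Vy|] /=.
    by apply/circle_arcE; exists (s * f y) => //; exact: sfV.
  by move=> /(circle_pos_turn sf2); lra.
move=> x Vx; apply: contrapT => nUx.
have bW := nbhs0_absorbing ltau W0.
have gW := gauge_sublinear aW bW.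
have [f [fl fp fx]] := hahn_banach (2^-1 *: x) gW.
have [_ fD fZ] := linear_facts fl.
have fW y : W y -> `|4^-1 * f y| <= 1/4.
  move=> Wy; have fN : f (- y) = - f y by rewrite -scaleN1r fZ mulN1r.
  have WN : W (- y) by rewrite -scaleN1r; apply: aW.2; rewrite ?normrN1.
  have := le_trans (fp y) (gauge_le1 bW Wy).
  have := le_trans (fp (- y)) (gauge_le1 bW WN).
  by rewrite fN ler_norml => ? ?; apply/andP; split; lra.
have gl : linear (fun y => 4^-1 * f y : R^o).
  by move=> k u v; rewrite fD fZ /= mulrDr mulrCA.
have gc := functional_continuous ltau gl W0 fW.
have : 1 <= gauge W (2^-1 *: x).
  apply: gauge_ge1 => // /WU /=.
  by rewrite scalerA divff ?scale1r// gt_eqF.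
have := ler_norm (4^-1 * f x); have := Vx _ gc fW.
by rewrite -fx fZ; lra.
Qed.

End characters_of_lcs.

(** * The weak* dual and the bipolar theorem *)

Section weak_star.
Variables (R : realType) (E : lmodType R) (tau : Topological E).
Notation E' := (topological_dual tau).
Implicit Types (C D : set E') (f g c : E').

Lemma cvg_topological_dual (F : set_system E') f : Filter F ->
  F --> f <-> forall x, (fun g : E' => g x : R^o) @ F --> (f x : R^o).
Proof. exact: cvg_initial_ptws. Qed.

Lemma topological_dualP f : continuous_functionals tau f.
Proof. exact/asboolP/functionalP. Qed.

Lemma topological_dualE f : [/\ f 0 = 0, {morph (f : E -> R^o) : x y / x + y} &
  forall t x, f (t *: x) = t * f x].
Proof. by apply: linear_facts; have [] := topological_dualP f. Qed.

Lemma continuous_evaluation x : continuous (fun f : E' => f x : R^o).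
Proof.
move=> f; have /cvg_topological_dual := @cvg_id _ (nbhs (f : E')); exact.
Qed.

Lemma CAC0 C : CAC tau C -> C 0.
Proof. by move=> [_ aC C0]; exact: absolutely_convex0. Qed.

Lemma CACN C c : CAC tau C -> C c -> C (- c).
Proof.
by move=> [_ aC _] Cc; rewrite -scaleN1r; apply: aC.2 => //; rewrite normrN1.
Qed.

Lemma continuous_dualD : continuous (fun z : E' * E' => z.1 + z.2).
Proof.
move=> z; apply/cvg_topological_dual => x.
suff : (fun w : E' * E' => w.1 x + w.2 x : R^o) @ z --> (z.1 x + z.2 x : R^o) by [].
apply: cvgD.
  apply: (@continuous_comp _ _ _ fst (fun f : E' => f x : R^o)).
    exact: cvg_fst.
  exact: continuous_evaluation.
apply: (@continuous_comp _ _ _ snd (fun f : E' => f x : R^o)).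
  exact: cvg_snd.
exact: continuous_evaluation.
Qed.

Lemma CACD C D : CAC tau C -> CAC tau D -> CAC tau (setsum C D).
Proof.
move=> hC hD; have [cC [convC balC] _] := hC; have [cD [convD balD] _] := hD.
split; last by exists 0, 0; [exact: CAC0|exists 0; [exact: CAC0|rewrite addr0]].
  have -> : setsum C D = (fun z : E' * E' => z.1 + z.2) @` (C `*` D).
    apply/seteqP; split=> [_ [c Cc [d Dd <-]]|_ [[c d] /= [Cc Dd] <-]].
      by exists (c, d).
    by exists c => //; exists d.
  apply: continuous_compact; last exact: compact_setX.
  by apply: continuous_subspaceT; exact: continuous_dualD.
split=> [|a g a1 [c Cc [d Dd <-]]]; last first.
  by exists (a *: c); [exact: balC|exists (a *: d); [exact: balD|rewrite scalerDr]].
apply/convex_setP => _ _ t t01 [c Cc [d Dd <-]] [c' Cc' [d' Dd' <-]].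
have /convex_setP hcC := convC; have /convex_setP hcD := convD.
exists (t *: c + (1 - t) *: c'); first exact: hcC.
by exists (t *: d + (1 - t) *: d'); [exact: hcD|rewrite !scalerDr addrACA].
Qed.

Lemma CAC_segment f : CAC tau [set t *: f | t in `[(-1 : R), 1]].
Proof.
split.
- apply: continuous_compact; last exact: segment_compact.
  apply: continuous_subspaceT => t; apply/cvg_topological_dual => x.
  suff : (fun s : R => s * f x : R^o) @ t --> (t * f x : R^o) by [].
  by apply: cvgM; [exact: cvg_id|exact: cvg_cst].
- split=> [|a g a1 [t /=]]; last first.
    rewrite in_itv/= -ler_norml => t1 <-; exists (a * t); last by rewrite scalerA.
    by rewrite /= in_itv/= -ler_norml normrM mulr_ile1.
  apply/convex_setP => _ _ t /andP[t0 t1] [s + <-] [s' + <-]; rewrite /= !in_itv/=.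
  move=> s1 s1'; exists (t * s + (1 - t) * s'); last by rewrite !scalerA -scalerDl.
  by rewrite /= in_itv/=; apply/andP; split; nra.
- by exists (0 *: f), 0 => //=; rewrite in_itv/=; apply/andP; split; lra.
Qed.

Lemma CAC_bounded C x : CAC tau C -> exists M, forall c, C c -> `|c x| <= M.
Proof.
move=> hC; have [cC _ C0] := hC.
have [|c /set_mem Cc cmax] := @compact_EVT_max _ _ (fun f : E' => f x) C C0 cC.
  by apply: continuous_subspaceT; exact: continuous_evaluation.
exists (c x) => c' Cc'; rewrite ler_norml cmax ?inE// andbT.
by rewrite lerNl; apply: (cmax (- c')); rewrite inE; exact: CACN.
Qed.

Lemma continuous_square_distance (phi : E -> R) (s : seq E) :
  continuous (fun c : E' => \sum_(x <- s) (c x - phi x) ^+ 2 : R).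
Proof.
elim: s => [|x s ih].
  by under eq_fun do rewrite big_nil; exact: cst_continuous.
under eq_fun do rewrite big_cons.
move=> c.
have h : (fun g : E' => g x - phi x : R) @ c --> (c x - phi x : R).
  exact: (cvgB (@continuous_evaluation x c) (cvg_cst _)).
have h2 : (fun g : E' => (g x - phi x) ^+ 2 : R) @ c --> ((c x - phi x) ^+ 2 : R).
  exact: (@cvg_comp _ _ _ _ (fun u : R => u ^+ 2) _ _ _ h
    (@exprn_continuous R 2 _)).
exact: (cvgD h2 (ih c)).
Qed.

(** Finite-dimensional part of the bipolar theorem: [c] minimizes over [C] the
Euclidean distance of the values at the points of [s] to those of [phi], and
[phi] cannot be separated from [C] by a combination of these points. *)
Lemma bipolar_finite C (phi : E -> R^o) (s : seq E) : CAC tau C -> linear phi ->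
  (forall x, (forall c, C c -> `|c x| <= 1) -> `|phi x| <= 1) ->
  exists2 c, C c & forall x, x \in s -> c x = phi x.
Proof.
move=> hC phil Cphi; have [phi0 phiD phiZ] := linear_facts phil.
have dl (c : E') : linear (c : E -> R^o) by have [] := topological_dualP c.
have [cC [convC balC] C0] := hC.
pose J (c : E') : R := \sum_(x <- s) (c x - phi x) ^+ 2.
have cJ : continuous J := @continuous_square_distance phi s.
have [c0 /set_mem Cc0 c0min] := compact_EVT_min C0 cC (continuous_subspaceT cJ).
exists c0 => //.
pose a x := phi x - c0 x; pose y := \sum_(x <- s) a x *: x.
have sumE (g : E -> R^o) : linear g -> g y = \sum_(x <- s) a x * g x.
  move=> /linear_facts[g0 gD gZ]; rewrite (big_morph g gD g0).
  by apply: eq_bigr => x _; exact: gZ.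
have c0max c : C c -> c y <= c0 y.
  move=> Cc; rewrite leNgt; apply/negP => cy.
  pose A := \sum_(x <- s) (c x - c0 x) ^+ 2.
  pose B := c y - c0 y; have B0 : 0 < B by rewrite subr_gt0.
  have A0 : 0 <= A by apply: sumr_ge0 => x _; exact: sqr_ge0.
  (* The derivative of [J] at [c0] in the direction [c - c0] is [- 2 * B], and
     [t] is small enough for the first-order term to dominate. *)
  pose t := B / (A + B); have AB0 : 0 < A + B by lra.
  have t0 : 0 < t by rewrite divr_gt0.
  have t1 : t <= 1 by rewrite ler_pdivrMr//; lra.
  have tAB : t * (A + B) = B by rewrite /t mulfVK// gt_eqF.
  pose ct : E' := t *: c + (1 - t) *: c0.
  have Cct : C ct.
    by have /convex_setP h := convC; apply: h => //; rewrite (ltW t0).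
  have Jct : J ct = J c0 + t ^+ 2 * A - 2 * t * B.
    have -> : B = \sum_(x <- s) a x * (c x - c0 x).
      rewrite /B (sumE c)// (sumE c0)// -sumrB.
      by apply: eq_bigr => x _; rewrite mulrBr.
    rewrite /J /A !mulr_sumr -big_split/= -sumrB; apply: eq_bigr => x _.
    transitivity ((t * c x + (1 - t) * c0 x - phi x) ^+ 2); first by [].
    by rewrite /a; ring.
  have := c0min ct; rewrite inE => /(_ Cct); rewrite Jct.
  nra.
have cyle c : C c -> `|c y| <= c0 y.
  move=> Cc; rewrite ler_norml c0max// andbT lerNl.
  by apply: (c0max (- c)); exact: CACN.
have phiy : phi y <= c0 y.
  have m0 : 0 <= c0 y by apply: le_trans (cyle _ Cc0).
  apply/ler_addgt0Pr => e e0; have me : 0 < c0 y + e by lra.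
  have : `|phi ((c0 y + e)^-1 *: y)| <= 1.
    apply: Cphi => c /cyle cy; have [_ _ cZ] := topological_dualE c.
    rewrite cZ normrM gtr0_norm ?invr_gt0// ler_pdivrMl// mulr1; lra.
  rewrite phiZ normrM gtr0_norm ?invr_gt0// ler_pdivrMl// mulr1.
  exact: le_trans (ler_norm _).
have sq0 : \sum_(x <- s) a x ^+ 2 = 0.
  apply/eqP; rewrite eq_le sumr_ge0 ?andbT => [|x _]; last exact: sqr_ge0.
  have -> : \sum_(x <- s) a x ^+ 2 = phi y - c0 y; last by rewrite subr_le0.
  rewrite (sumE phi)// (sumE c0)// -sumrB; apply: eq_bigr => x _.
  by rewrite -mulrBr.
move=> x xs; apply/esym/eqP; rewrite -subr_eq0 -sqrf_eq0; move/eqP: sq0.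
rewrite psumr_eq0 => [|z _]; last exact: sqr_ge0.
by move=> /allP/(_ x xs).
Qed.

(** The bipolar theorem for a weak* compact absolutely convex set [C]: a linear
functional, continuous or not, that is bounded by [1] on the polar of [C]
belongs to [C]. *)
Lemma bipolar C (phi : E -> R^o) : CAC tau C -> linear phi ->
  (forall x, (forall c, C c -> `|c x| <= 1) -> `|phi x| <= 1) ->
  exists2 c, C c & phi = c.
Proof.
move=> hC phil Cphi; have [cC _ _] := hC.
(* The sets [D s] generate a filter on [C]; by compactness it clusters at some
   [c], which agrees with [phi] at every point. *)
pose D (s : seq E) : set E' := [set c | C c /\ forall x, x \in s -> c x = phi x].
have FF : ProperFilter (filter_from setT D).
  apply: filter_from_proper => [|s _]; last first.
    by have [c Cc cs] := bipolar_finite s hC phil Cphi; exists c.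
  apply: filter_from_filter; first by exists [::].
  move=> s s' _ _; exists (s ++ s') => // c [Cc cs].
  by split; split=> // x xs; apply: cs; rewrite mem_cat xs ?orbT.
have [|c [Cc clc]] := cC _ FF; first by exists [::] => // c [].
exists c => //; apply/funext => x; apply/esym/eqP.
apply: contrapT => /negP cx.
have ox : open [set g : E' | g x != phi x].
  have /continuousP := @continuous_evaluation x.
  move=> /(_ (~` [set phi x])) h; rewrite (_ : [set g | _] =
    (fun f : E' => f x : R^o) @^-1` ~` [set phi x]).
    apply: h; apply: closed_openC; apply: compact_closed; last exact: compact_set1.
    exact: Rhausdorff.
  by apply/seteqP; split=> g /=; [move=> /eqP|move=> h'; apply/eqP].
have [||g [[_ gx] /= /eqP]] := clc (D [:: x]) [set g : E' | g x != phi x].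
  by exists [:: x].
  exact: open_nbhs_nbhs.
by apply; apply: gx; rewrite mem_head.
Qed.

End weak_star.

(** * The Mackey topology *)

Section alaoglu.
Variables (R : realType) (E : lmodType R) (tau : Topological E).
Hypothesis ltau : lcs_topology tau.
Notation E' := (topological_dual tau).

(** The theorem of Alaoglu: polars of neighborhoods are weak* compact. *)
Lemma CAC_equicontinuous (W : set E) : nbhs_in tau 0 W ->
  CAC tau [set f : E' | forall x, W x -> `|f x| <= 1/4].
Proof.
move=> W0; split; last first.
- by exists 0 => x _; rewrite normr0; lra.
- split=> [|a f a1 fW x Wx]; last first.
    apply: le_trans (fW x Wx); rewrite normrM ler_piMl//.
  apply/convex_setP => f g t /andP[t0 t1] fW gW x Wx.
  have t1' : 0 <= 1 - t by lra.
  have -> : (1/4 : R) = t * (1/4) + (1 - t) * (1/4) by ring.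
  apply: (le_trans (ler_normD (t * f x) ((1 - t) * g x))).
  rewrite !normrM (ger0_norm t0) (ger0_norm t1').
  by apply: lerD; apply: ler_wpM2l => //; [exact: fW|exact: gW].
rewrite compact_ultra => F UF FW.
have H x : exists l : R^o, (fun g : E' => g x : R^o) @ F --> l.
  have [d d0 Wd] := nbhs0_absorbing ltau W0 x.
  have [|l _ Fl] := @ultra_limit _ R^o F (fun g : E' => g x)
      `[- (d^-1 / 4), d^-1 / 4] UF (@segment_compact R _ _); last by exists l.
  apply: filterS FW => f fW; have := fW _ Wd; have [_ _ fZ] := topological_dualE f.
  rewrite /= fZ in_itv/= -ler_norml normrM gtr0_norm// mulrC -ler_pdivlMr//.
  by rewrite mul1r mulrC.
have [phi Fphi] := choice H.
have phil : linear phi.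
  move=> k x y; apply: (cvg_unique (@Rhausdorff R) (Fphi (k *: x + y))).
  have e : (fun g : E' => g (k *: x + y) : R^o) =
      (fun g : E' => k * g x + g y : R^o).
    by apply/funext => g; have [_ gD gZ] := topological_dualE g; rewrite gD gZ.
  rewrite e; apply: (@cvgD _ R^o _ F); last exact: Fphi.
  exact: (@cvgM _ _ F _ (fun=> k) _ _ _ (cvg_cst k) (Fphi x)).
have phiW x : W x -> `|phi x| <= 1/4.
  move=> Wx; have : (`[- (1/4), 1/4]%classic : set R) (phi x).
    apply: (closed_cvg (`[- (1/4), 1/4]%classic : set R) _ _ _ (Fphi x)).
      exact: itv_closed.
    by apply: filterS FW => f /(_ x Wx); rewrite /= in_itv/= -ler_norml.
  by rewrite /= in_itv/= -ler_norml.
have phic : phi \in is_continuous_functional tau.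
  by apply/asboolP; exact: (functional_continuous ltau phil W0 phiW).
by exists (Functional phic); split => //; apply/cvg_topological_dual.
Qed.

(** Continuous linear functionals separate the points. *)
Lemma separating_functional x : x != 0 -> exists f : E', f x != 0.
Proof.
move=> x0.
have [chi chix] := separating_character (lcs_locally_quasi_convex ltau) x0.
have [f fc chif] := character_lift ltau (dual_groupP chi).
have fP : f \in is_continuous_functional tau by exact/asboolP.
exists (Functional fP); apply/eqP => /= fx; apply: chix.
by rewrite chif fx turn0; apply/circle_arcE/circle_arc0; lra.
Qed.

(** A basic neighborhood of [0] of the Mackey topology. *)
Definition small (C : set E') (e : R) : set E :=
  [set x | forall c, C c -> `|c x| <= e].

Definition smalls : set_system E :=
  [set U | exists C e, [/\ CAC tau C, 0 < e & U = small C e]].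

Lemma smallsI (C D : set E') e e' : CAC tau C -> CAC tau D ->
  small (setsum C D) (Num.min e e') `<=` small C e `&` small D e'.
Proof.
move=> hC hD x xCD; split=> c Cc.
  apply: le_trans (xCD c _) _; last by rewrite ge_min lexx.
  by exists c => //; exists 0; [exact: CAC0|rewrite addr0].
apply: le_trans (xCD c _) _; last by rewrite ge_min lexx orbT.
by exists 0; [exact: CAC0|exists c => //; rewrite add0r].
Qed.

Lemma smalls_base : group_base smalls.
Proof.
split.
- exists (small [set t *: (0 : E') | t in `[(-1 : R), 1]] 1).
  exists [set t *: (0 : E') | t in `[(-1 : R), 1]], 1.
  by split=> //; exact: CAC_segment.
- move=> _ _ [C [e [hC e0 ->]]] [D [e' [hD e'0 ->]]].
  exists (small (setsum C D) (Num.min e e')); last exact: smallsI.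
  exists (setsum C D), (Num.min e e'); split=> //; first exact: CACD.
  by rewrite lt_min e0.
- move=> _ [C [e [hC e0 ->]]] c _; have [c0 _ _] := topological_dualE c.
  by rewrite c0 normr0 ltW.
- move=> _ [C [e [hC e0 ->]]]; exists (small C (e / 2)).
    by exists C, (e / 2); split=> //; rewrite divr_gt0.
  move=> x y xC yC c Cc; have [_ cD _] := topological_dualE c.
  by rewrite cD (le_trans (ler_normD _ _))// [e]splitr lerD//; [exact: xC|exact: yC].
- move=> _ [C [e [hC e0 ->]]]; exists (small C e); first by exists C, e.
  move=> x xC c Cc; have [_ _ cZ] := topological_dualE c.
  by rewrite -scaleN1r cZ mulN1r normrN; exact: xC.
Qed.

(** The topology of uniform convergence on the weak* compact absolutely convex
sets. *)
Definition Mackey_topology : Topological E := base_topology smalls_base.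

Lemma nbhs_small C e : CAC tau C -> 0 < e -> nbhs_in Mackey_topology 0 (small C e).
Proof. by move=> hC e0; apply/nbhs0_base; exists (small C e) => //; exists C, e. Qed.

Lemma convex_small C e : convex_set (small C e).
Proof.
apply/convex_setP => x y t /andP[t0 t1] xC yC c Cc.
have [_ cD cZ] := topological_dualE c; have t1' : 0 <= 1 - t by lra.
rewrite cD !cZ (le_trans (ler_normD _ _))// !normrM (ger0_norm t0) (ger0_norm t1').
have -> : e = t * e + (1 - t) * e by ring.
by apply: lerD; apply: ler_wpM2l => //; [exact: xC|exact: yC].
Qed.

Lemma Mackey_topology_lcs : lcs_topology Mackey_topology.
Proof.
have gm : group_topology Mackey_topology := base_group_topology smalls_base.
split; first exact: gm.1.
- move=> [a x] U /(nbhs_base smalls_base)[_ [C [e [hC e0 ->]]] CU].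
  have [M CM] := CAC_bounded x hC; pose M' := `|M| + 1.
  have M0 : 0 < M' by rewrite ltr_wpDl.
  pose k := `|a| + 1; have k0 : 0 < k by rewrite ltr_wpDl.
  pose d := Num.min 1 (e / 2 / M').
  have d0 : 0 < d by rewrite lt_min ltr01 !divr_gt0.
  exists ([set s : R^o | `|s - a| < d],
    [set y : E | small C (e / 2 / k) (y - x)]) => /=.
    split; last first.
      apply/(nbhs_addl gm x); have e2 : 0 < e / 2 / k by rewrite !divr_gt0.
      by apply: filterS (nbhs_small hC e2) => y; rewrite /= addrAC subrr add0r.
    by apply/nbhs_ballP; exists d => // s; rewrite /ball/= distrC.
  move=> [s y] /= [sa yx].
  have -> : s *: y = a *: x + ((s - a) *: x + s *: (y - x)).
    by rewrite scalerBr scalerBl addrA subrKC subrKC.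
  apply: CU => c Cc; have [_ cD cZ] := topological_dualE c.
  rewrite cD !cZ (le_trans (ler_normD _ _))// !normrM [e]splitr.
  move: sa; rewrite lt_min => /andP[sa1 sa2].
  have cxM : `|c x| <= M'.
    by rewrite (le_trans (CM c Cc))// /M'; have := ler_norm M; lra.
  have sk : `|s| <= k by rewrite /k; have := ler_normD (s - a) a; rewrite subrK; lra.
  apply: lerD.
    apply: (@le_trans _ _ (`|s - a| * M')); first by rewrite ler_wpM2l.
    by rewrite -ler_pdivlMr// ltW.
  apply: (@le_trans _ _ (k * `|c (y - x)|)); first by rewrite ler_wpM2r.
  by rewrite mulrC -ler_pdivlMr//; exact: yx.
- exists [set b : set E |
    @open (Topological.Pack Mackey_topology) b /\ convex_set b].
    by move=> b [].
  split; first by move=> b [].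
  move=> x U /(nbhs_base smalls_base)[V [C [e [hC e0 VE]]] VU].
  have nV : nbhs_in Mackey_topology x [set y | small C e (y - x)].
    apply/(nbhs_addl gm x); apply: filterS (nbhs_small hC e0) => y.
    by rewrite /= addrAC subrr add0r.
  (* The interior of a convex set is convex. *)
  exists (@interior (Topological.Pack Mackey_topology)
    [set y | small C e (y - x)]).
    split; last exact: nV.
    split; first exact: open_interior.
    apply/convex_setP => y z t t01 /(nbhs_base smalls_base)[V1 SV1 hy].
    move=> /(nbhs_base smalls_base)[V2 SV2 hz].
    apply/(nbhs_base smalls_base).
    have [V3 SV3 V312] := group_baseI smalls_base SV1 SV2.
    exists V3 => // u /V312[/hy yu /hz zu] /=.
    have /convex_setP h := @convex_small C e.
    have -> : t *: y + (1 - t) *: z + u - x =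
       t *: (y + u - x) + (1 - t) *: (z + u - x).
      rewrite -[LHS]addrA -[y + u - x]addrA -[z + u - x]addrA (scalerDr t y).
      by rewrite (scalerDr (1 - t) z) [RHS]addrACA -scalerDl subrKC scale1r.
    exact: h.
  move=> y /interior_subset/= hy; rewrite -(subrKC x y); apply: VU; rewrite VE.
  exact: hy.
- apply: (hausdorff_group gm) => x /separating_functional[f fx].
  have f2 : 0 < `|f x| / 2 by rewrite divr_gt0// normr_gt0.
  exists (small [set t *: f | t in `[(-1 : R), 1]] (`|f x| / 2)).
    by apply: nbhs_small => //; exact: CAC_segment.
  move=> /(_ f); have h : [set t *: f | t in `[(-1 : R), 1]] f.
    by exists 1; rewrite ?scale1r//= in_itv/=; apply/andP; split; lra.
  by move=> /(_ h); lra.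
Qed.

(** The Mackey topology has the same continuous functionals as [tau]. A functional
bounded by [1] on [small C e] is, up to the factor [e], in [C] by the bipolar
theorem. *)
Lemma continuous_functionals_Mackey :
  continuous_functionals Mackey_topology = continuous_functionals tau.
Proof.
apply/seteqP; split=> [phi phic|f fc]; last first.
  have fP : f \in is_continuous_functional tau by exact/asboolP.
  have hC := CAC_segment (Functional fP).
  apply: (functional_continuous Mackey_topology_lcs fc.1 (nbhs_small hC ltr01)).
  move=> x /(_ (Functional fP)); apply.
  by exists 1; rewrite ?scale1r//= in_itv/=; apply/andP; split; lra.
have [phi0 phiD phiZ] := linear_facts phic.1.
have := functional_bounded phic ltr01.
move=> /(nbhs0_base smalls_base)[_ [C [e [hC e0 ->]]] Cphi].
have [||c Cc ec] := @bipolar _ _ _ C (fun x => e * phi x : R^o) hC.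
- by move=> k x y; rewrite phiD phiZ /= mulrDr mulrCA.
- move=> x xC; rewrite -phiZ; apply: Cphi => c Cc.
  have [_ _ cZ] := topological_dualE c.
  by rewrite cZ normrM gtr0_norm// ler_piMr ?xC// ltW.
have -> : phi = e^-1 *: c.
  apply/funext => x; have := congr1 (@^~ x) ec => /= ecx.
  transitivity (e^-1 * c x); last by [].
  by rewrite -ecx mulKf// gt_eqF.
exact: topological_dualP.
Qed.

End alaoglu.

Lemma coarser_nbhs (T : Type) (nu tau : Topological T) (x : T) :
  coarser nu tau -> nbhs_in nu x `<=` nbhs_in tau x.
Proof.
move=> h A; rewrite !nbhsE => -[B [oB Bx] BA].
by exists B => //; split=> //; exact: h.
Qed.

Lemma lcs_characters (R : realType) (E : lmodType R) (nu tau : Topological E) :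
  lcs_topology nu -> lcs_topology tau ->
  continuous_functionals nu = continuous_functionals tau ->
  characters R nu = characters R tau.
Proof.
move=> lnu ltau e; apply/seteqP; split=> chi.
  by move=> /(character_lift lnu)[f fc ->]; apply: turn_functional; rewrite -e.
by move=> /(character_lift ltau)[f fc ->]; apply: turn_functional; rewrite e.
Qed.

Lemma tvs_lcs (R : realType) (E : tvsType R) : hausdorff_space E ->
  lcs_topology (Topological.class E : Topological E).
Proof.
move=> hE; split=> //; first exact: add_continuous.
  exact: scale_continuous.
have [B convB basisB] := @locally_convex R E.
by exists B => // b Bb; apply: convB; rewrite inE.
Qed.

(** * Mackey groups and Mackey spaces *)

Theorem theorem4p5 (R : realType) (E : tvsType R) (hE : hausdorff_space E) :
  let mu : Topological E := Topological.class E in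
  mackey_group R mu <->
  (mackey_space mu /\
   swallows [set @psi R E mu @` C | C in CAC mu] (Mac R mu)).
Proof.
move=> mu; have lmu : lcs_topology mu := tvs_lcs hE.
have lqcmu := lcs_locally_quasi_convex lmu; have gmu := lcs_group lmu.
split=> [[_ Mmu]|[[_ Mmu] sw]].
  split.
    split=> // nu lnu e; apply: Mmu; first exact: lcs_locally_quasi_convex.
    exact: lcs_characters.
  (* The topology of uniform convergence on [K] is compatible, so [mu] is finer
     and [K] is equicontinuous for [mu]; Alaoglu gives the larger set. *)
  move=> K MacK.
  have nuK := Mmu _ (Mac_topology_lqc lqcmu MacK) (characters_Mac_topology MacK).
  have /(lcs_abs_convex lmu) := coarser_nbhs nuK (Mac_topology_polar K).
  move=> [W [W0 aW WK]].
  exists [set psi f | f in [set f : topological_dual mu |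
      forall x, W x -> `|f x| <= 1/4]].
    by eexists; [exact: (CAC_equicontinuous lmu W0)|].
  move=> chi Kchi; have [f fc chif] := character_lift lmu (dual_groupP chi).
  have fP : f \in is_continuous_functional mu by exact/asboolP.
  exists (Functional fP); last by apply: val_inj; rewrite /= chif.
  apply: (balanced_bound fc.1 aW.2) => x /WK/(_ chi Kchi).
  by rewrite chif.
split=> // nu lqcnu numu.
(* A quasi-convex neighborhood [V] for [nu] is the prepolar of its polar, which
   lies in some [psi @` C]; so [V] contains a neighborhood for the Mackey
   topology, which is [mu]. *)
have [gnu _ qnu] := lqcnu.
apply: coarser_nbhs0 => // U /qnu[V [V0 qV VU]].
have [_ [C hC <-] KC] := sw _ (Mac_polar gnu numu V0).
have mM : coarser (Mackey_topology mu) mu.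
  apply: Mmu; first exact: Mackey_topology_lcs.
  exact: continuous_functionals_Mackey.
have e4 : 0 < (1/4 : R) by lra.
have := coarser_nbhs mM (nbhs_small hC e4).
apply: filterS => x xC; apply: VU; apply: contrapT => /qV[chi [chiV chix]].
have chiP : (chi : E -> circle R) \in is_character R mu.
  by apply/is_characterP; rewrite -numu; exact: dual_groupP.
have [f Cf fchi] := KC (Character chiP) chiV.
apply: chix; have -> : chi x = turn (f x).
  by have := congr1 (fun c : dual_group R mu => c x) fchi.
by apply/circle_arcE; exists (f x) => //; exact: xC.
Qed.
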